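(* Let $F$ be a field, $m\ge3$, $k=\binom m2$ and $1\le K\le k$. The maximal Krull dimension of a component of a linear section of $G(2,m)$ with a linear subspace of the Plücker space $\mathbf P^{k-1}$ of projective dimension $K-1$ is the largest $d$ (with $0\le d\le2(m-2)$) such that $C(d)\le K$.
   Context: $G(2,m)$ is the Grassmann variety of $2$-dimensional subspaces of an $m$-dimensional $F$-vector space, embedded in $\mathbf P^{k-1}$ by Plücker coordinates; it has Krull dimension $2(m-2)$. If $F$ is not algebraically closed, the linear subspaces are those defined over $F$. The function $C(d)$ is defined, for integers $0\le d\le2(m-2)$, as follows. For $d\le m-2$, $C(d)=d+1$. For $d\ge m-2$, $C(d)=\min\{c_1(d),c_2(d)\}$, where $$c_1(d)=(d-m+3)m-\frac{(d-m+3)(d-m+4)}2=\frac{4dm-3m^2-d^2+13m-7d-12}{2},$$ and $c_2(d)=\frac{d^2+6d+8}{8}$ if $d$ is even, $c_2(d)=\frac{d^2+8d+7}{8}$ if $d$ is odd. (The two definitions agree for $d=m-2$.) *)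

(* Defs.v *)
From HB Require Import structures.
From mathcomp Require Import all_boot all_order all_algebra.
From mathcomp Require Import boolp classical_sets.
From mathcomp Require Import mpoly.

Set Implicit Arguments.
Unset Strict Implicit.
Unset Printing Implicit Defensive.

Import Order.TTheory GRing.Theory Num.Theory.

Local Open Scope classical_set_scope.
Local Open Scope ring_scope.

Definition is_maximum (P : nat -> Prop) (d : nat) : Prop :=
  P d /\ forall e : nat, P e -> (e <= d)%N.

(* Projective n-1 space over an arbitrary (possibly finite) field F is the
   scheme Proj F[X_0, ..., X_(n-1)]: its points are the homogeneous prime
   ideals that do not contain the irrelevant ideal.  F-rational points alone
   would not give a meaningful dimension. *)
Section Proj.
Variables (F : fieldType) (n : nat).
Implicit Types (p A : set {mpoly F[n]}) (X Y Z : set (set {mpoly F[n]})).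

Definition proper_homogeneous_ideal p : Prop :=
  idealr_closed [pred f | f \in p] /\
  forall (f : {mpoly F[n]}) (d : nat), p f -> p (pihomog mdeg d f).

Definition Proj : set (set {mpoly F[n]}) :=
  [set p | [/\ proper_homogeneous_ideal p, prime_idealr_closed [pred f | f \in p] &
               exists i : 'I_n, ~ p 'X_i]].

Definition zero_locus A : set (set {mpoly F[n]}) :=
  [set p | Proj p /\ A `<=` p].

Definition Zariski_closed Z : Prop := exists A, Z = zero_locus A.

Definition irreducible_closed Z : Prop :=
  [/\ Zariski_closed Z, Z !=set0 &
      forall X Y, Zariski_closed X -> Zariski_closed Y ->
        Z `<=` X `|` Y -> Z `<=` X \/ Z `<=` Y].

Definition component X Z : Prop :=
  [/\ irreducible_closed Z, Z `<=` X &
      forall Y, irreducible_closed Y -> Y `<=` X -> Z `<=` Y -> Y = Z].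

Definition irreducible_chain Z (l : nat) (c : nat -> set (set {mpoly F[n]})) :
    Prop :=
  (forall i : nat, (i <= l)%N -> irreducible_closed (c i) /\ c i `<=` Z) /\
  (forall i : nat, (i < l)%N -> c i `<` c i.+1).

(* Z is Zariski closed in all uses, so that its closed subsets are the closed
   subsets of the projective space that are contained in it. *)
Definition Krull_dim Z (d : nat) : Prop :=
  is_maximum (fun l => exists c, irreducible_chain Z l c) d.

Definition linear_subspace (U : {vspace 'rV[F]_n}) :
    set (set {mpoly F[n]}) :=
  zero_locus [set f | f \is 1.-homog /\
                      forall u : 'rV[F]_n, u \in U -> f.@[u 0] = 0].

End Proj.

Definition plucker_index (m : nat) : {set 'I_m * 'I_m} :=
  [set ij : 'I_m * 'I_m | (ij.1 < ij.2)%N].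

Definition nplucker (m : nat) : nat := #|plucker_index m|.

Lemma npluckerE (m : nat) : nplucker m = 'C(m, 2).
Proof.
rewrite -bin2_sum big_mkord /nplucker -sum1_card.
rewrite (eq_bigl (fun ij : 'I_m * 'I_m => true && (ij.1 < ij.2)%N)) => [|ij];
  last by rewrite inE.
rewrite -(pair_big_dep xpredT (fun i j : 'I_m => (i < j)%N) (fun _ _ => 1%N)).
rewrite (exchange_big_dep xpredT) //=; apply: eq_bigr => j _.
by rewrite -(big_ord_widen _ (fun=> 1%N) (ltnW (ltn_ord j))) sum1_card card_ord.
Qed.

(* The Pluecker coordinates of the row space of a 2 x m matrix. *)
Definition plucker (L : fieldType) (m : nat) (M : 'M[L]_(2, m))
    (e : 'I_(nplucker m)) : L :=
  let: (i, j) := enum_val e in M 0 i * M 1 j - M 0 j * M 1 i.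

(* The polynomials over F vanishing at the Pluecker coordinates of all
   2-dimensional subspaces of L ^ m, for all field extensions L / F; a subspace
   is given by a basis, the rows of the rank 2 matrix W.  L = F would suffice
   for infinite F, but not for finite F. *)
Definition grassmannian_ideal (F : fieldType) (m : nat) :
    set {mpoly F[nplucker m]} :=
  [set f | forall (L : fieldType) (iota : {rmorphism F -> L})
             (W : 'M[L]_(2, m)),
             \rank W = 2%N -> (map_mpoly iota f).@[plucker W] = 0].

Definition grassmannian (F : fieldType) (m : nat) :
    set (set {mpoly F[nplucker m]}) :=
  zero_locus (@grassmannian_ideal F m).

Definition linear_section (F : fieldType) (m : nat)
    (U : {vspace 'rV[F]_(nplucker m)}) : set (set {mpoly F[nplucker m]}) :=
  @grassmannian F m `&` linear_subspace U.

(* Rational-valued, so that neither the differences nor the quotients are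
   truncated. *)
Definition c1 (m d : nat) : rat :=
  (d%:R - m%:R + 3) * m%:R - (d%:R - m%:R + 3) * (d%:R - m%:R + 4) / 2.

Definition c2 (d : nat) : rat :=
  if odd d then (d%:R ^+ 2 + 8 * d%:R + 7) / 8
  else (d%:R ^+ 2 + 6 * d%:R + 8) / 8.

Definition C (m d : nat) : rat :=
  if (d <= m - 2)%N then d%:R + 1 else Num.min (c1 m d) (c2 d).

(* Main.v *)
(* A section of the Grassmannian by a K-dimensional U that contains a closed
   irreducible set of dimension l forces C(l) <= K by degeneration to a Schubert
   variety.  A chain of l + 1 homogeneous primes makes the Hilbert function of
   the coordinate ring of the section grow at least like the l-th power.  On the
   other hand, replacing the linear equations of U by their leading forms for
   the torus weights 2^i, and then alternating the column operations
   x_p -> x_p + x_q with such degenerations, can only increase the Hilbert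
   function, and ends at a coordinate subspace whose set T of coordinates has at
   most K elements and is an order ideal of pairs.  Using only the three-term
   Pluecker relations, the Hilbert function for T is seen to grow at most like
   the power max (a + b - 3) over the pairs (a, b) of T; since T contains all
   pairs below (a, b), K is at least the number of these, which is concave in a
   for fixed a + b, whence the two candidates c1 and c2 for its minimum.
   Conversely, the span of the Schubert variety of (a, b), extended to dimension
   K, gives a section containing this variety, and the bound just described
   shows that it is a component when its dimension is maximal. *)

Require Import Defs.
From HB Require Import structures.
From mathcomp Require Import all_boot all_order all_algebra.
From mathcomp Require Import boolp classical_sets.
From mathcomp Require Import mpoly zify ring lra.

Set Implicit Arguments.
Unset Strict Implicit.
Unset Printing Implicit Defensive.

Import Order.TTheory GRing.Theory Num.Theory.
Local Open Scope ring_scope.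

(** * Linear algebra modulo a subspace *)

Section LinearAlgebraModSubspace.
Variables (F : fieldType) (V : lmodType F).
Implicit Types (I : V -> Prop).

Definition subspace I : Prop :=
  I 0 /\ forall (a : F) u v, I u -> I v -> I (a *: u + v).

Lemma subspaceD I u v : subspace I -> I u -> I v -> I (u + v).
Proof. by move=> [_ sI] Iu Iv; rewrite -[u]scale1r; apply: sI. Qed.

Lemma subspaceZ I a u : subspace I -> I u -> I (a *: u).
Proof. by move=> [I0 sI] Iu; rewrite -[_ *: _]addr0; apply: sI. Qed.

Lemma subspaceN I u : subspace I -> I u -> I (- u).
Proof. by move=> sI Iu; rewrite -scaleN1r; apply: subspaceZ. Qed.

Lemma subspaceB I u v : subspace I -> I u -> I v -> I (u - v).
Proof. by move=> sI Iu Iv; apply: subspaceD => //; apply: subspaceN. Qed.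

Lemma subspace_sum I (J : eqType) (r : seq J) (P : pred J) (f : J -> V) :
  subspace I -> (forall i, i \in r -> P i -> I (f i)) ->
  I (\sum_(i <- r | P i) f i).
Proof.
move=> sI If; rewrite big_seq_cond; elim/big_rec: _ => [|i v /andP[ri Pi] Iv].
  by case: sI.
by apply: subspaceD => //; apply: If.
Qed.

(** The quotient by [I] is never formed: its dimension is only bounded, from above by families
    spanning modulo [I] and from below by families independent modulo [I]. *)
Definition span_mod I N (x : 'I_N -> V) (f : V) : Prop :=
  exists c : 'I_N -> F, I (f - \sum_i c i *: x i).

Definition indep_mod I N (x : 'I_N -> V) : Prop :=
  forall c : 'I_N -> F, I (\sum_i c i *: x i) -> forall i, c i = 0.

Lemma span_mod_subspace I N (x : 'I_N -> V) :
  subspace I -> subspace (span_mod I x).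
Proof.
move=> sI; split=> [|a u v [c Ic] [d Id]].
  exists (fun=> 0); rewrite big1 => [|i _]; last by rewrite scale0r.
  by rewrite subr0; case: sI.
exists (fun i => a * c i + d i).
under eq_bigr do rewrite scalerDl -scalerA.
rewrite big_split /= -scaler_sumr opprD addrACA -scalerBr.
by case: sI => _; apply.
Qed.

Lemma span_mod_sub I N (x : 'I_N -> V) f : I f -> span_mod I x f.
Proof.
move=> If; exists (fun=> 0); rewrite big1 ?subr0 // => i _; exact: scale0r.
Qed.

Lemma span_mod_gen I N (x : 'I_N -> V) i : subspace I -> span_mod I x (x i).
Proof.
move=> [I0 _]; exists (fun j => (j == i)%:R).
rewrite (bigD1 i) //= eqxx scale1r big1 ?addr0 ?subrr // => j /negPf ->.
exact: scale0r.
Qed.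

(** If [M < N], the matrix expressing the [x i] through the [y j] has a nonzero left kernel vector,
    which is a relation among the [x i] modulo [I]. *)
Lemma indep_le_span I N M (x : 'I_N -> V) (y : 'I_M -> V) :
  subspace I -> indep_mod I x -> (forall i, span_mod I y (x i)) -> (N <= M)%N.
Proof.
move=> sI xind /choice[c Ic]; rewrite leqNgt; apply/negP => ltMN.
pose A := \matrix_(i < N, j < M) c i j.
have kA0 : kermx A != 0.
  rewrite -mxrank_eq0 mxrank_ker subn_eq0 -ltnNge.
  exact: leq_ltn_trans (rank_leq_col _) ltMN.
have [i ui0] : exists i, row i (kermx A) != 0.
  apply/existsP; apply: contraNT kA0 => /existsPn u0; apply/eqP/row_matrixP => i.
  by have /negbNE/eqP -> := u0 i; rewrite row0.
have uA : row i (kermx A) *m A = 0 by rewrite -row_mul mulmx_ker row0.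
move: (row i _) ui0 uA => u ui0 uA; case/negP: ui0; apply/eqP/rowP => j.
rewrite mxE; apply: (xind (u 0)).
rewrite (_ : \sum_i _ = \sum_i u 0 i *: (x i - \sum_j c i j *: y j)).
  by apply: subspace_sum => // k _ _; apply: subspaceZ.
under [RHS]eq_bigr do rewrite scalerBr scaler_sumr.
rewrite sumrB exchange_big /= [X in _ - X]big1 ?subr0 // => k _.
under eq_bigr do rewrite scalerA.
rewrite -scaler_suml; have /rowP/(_ k) := uA; rewrite !mxE.
by under eq_bigr do rewrite mxE; move->; rewrite scale0r.
Qed.

Lemma indep_extract I (s : seq V) :
  subspace I -> exists N (x : 'I_N -> V),
    [/\ forall i, x i \in s, indep_mod I x & forall v, v \in s -> span_mod I x v].
Proof.
move=> sI; elim: s => [|v s [N [x [xs xind xspan]]]].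
  by exists 0%N, (fun=> 0); split=> [[]|? ? []|].
have [vx|vx] := EM (span_mod I x v).
  exists N, x; split=> // [i|u]; first by rewrite inE xs orbT.
  by rewrite inE => /predU1P[->//|]; apply: xspan.
pose y (i : 'I_N.+1) := oapp x v (unlift ord0 i).
have y0 : y ord0 = v by rewrite /y unlift_none.
have yS i : y (lift ord0 i) = x i by rewrite /y liftK.
have xy u : span_mod I x u -> span_mod I y u.
  move=> [c Ic]; exists (fun i => oapp c 0 (unlift ord0 i)).
  rewrite big_ord_recl unlift_none scale0r add0r.
  by under eq_bigr do rewrite yS liftK.
exists N.+1, y; split=> [i|c|u].
- case: (unliftP ord0 i) => [j|] ->; rewrite ?y0 ?yS inE ?eqxx ?xs ?orbT //.
- rewrite big_ord_recl y0; under eq_bigr do rewrite yS.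
  move=> Ic; have c0 : c ord0 = 0.
    apply/eqP; apply: contra_notT vx => c0.
    exists (fun i => - (c ord0)^-1 * c (lift ord0 i)).
    have /(_ _ Ic) := subspaceZ (c ord0)^-1 sI.
    rewrite scalerDr scalerA mulVf // scale1r scaler_sumr -sumrN.
    by under eq_bigr do rewrite scalerA -[_ *: _]opprK -scaleNr -mulNr.
  move: Ic; rewrite c0 scale0r add0r => Ic i.
  by case: (unliftP ord0 i) => [j|] ->//; apply: (xind (fun j => c (lift ord0 j))).
- rewrite inE => /predU1P[->|/xspan/xy//].
  by rewrite -y0; apply: span_mod_gen.
Qed.

End LinearAlgebraModSubspace.

(** * Hilbert functions and their degeneration *)

Section Ideals.
Variables (F : fieldType) (n : nat).
Local Notation S := {mpoly F[n]}.
Implicit Types (I : S -> Prop) (G : S -> Prop) (f g h : S).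

Definition ideal I : Prop :=
  I 0 /\ forall h u v, I u -> I v -> I (h * u + v).

Lemma ideal_subspace I : ideal I -> subspace I.
Proof.
by move=> [I0 iI]; split=> // a u v Iu Iv; rewrite -mul_mpolyC; apply: iI.
Qed.

Lemma idealM I h u : ideal I -> I u -> I (h * u).
Proof. by move=> [I0 iI] Iu; rewrite -[_ * _]addr0; apply: iI. Qed.

Inductive idl G : S -> Prop :=
| idl0 : idl G 0
| idlMD h g f : G g -> idl G f -> idl G (h * g + f).

Lemma idl_ideal G : ideal (idl G).
Proof.
split=> [|h u v]; first exact: idl0.
elim=> [|h' g f Gg _ IH] Iv; first by rewrite mulr0 add0r.
by rewrite mulrDr mulrA -addrA; apply: idlMD => //; apply: IH.
Qed.

Lemma idl_gen G g : G g -> idl G g.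
Proof.
by move=> Gg; rewrite -[g]mul1r -[_ * _]addr0; apply: idlMD => //; apply: idl0.
Qed.

Lemma idl_sub G I : ideal I -> (forall g, G g -> I g) -> forall f, idl G f -> I f.
Proof. by move=> [I0 iI] GI f; elim=> // h g f' Gg _ If'; apply/iI/If'/GI. Qed.

(** This and [hilbert_le] bound the Hilbert function of the quotient by [I] in degree [d] from below
    and from above. *)
Definition hilbert_ge I d N : Prop :=
  exists x : 'I_N -> S, (forall i, x i \is d.-homog) /\ indep_mod I x.

Definition hilbert_le I d N : Prop :=
  exists y : 'I_N -> S, (forall i, y i \is d.-homog) /\
    forall f, f \is d.-homog -> span_mod I y f.

Lemma hilbert_ge_le I d N M :
  subspace I -> hilbert_ge I d N -> hilbert_le I d M -> (N <= M)%N.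
Proof.
by move=> sI [x [xd xind]] [y [_ yspan]]; apply: (indep_le_span sI xind) => i; apply/yspan.
Qed.

(** Monomials span each degree, so a basis of the quotient can be extracted from them; being
    homogeneous for every weight, they stay usable under degeneration. *)
Lemma hilbert_le_monomial I d N : subspace I -> hilbert_le I d N ->
  exists M (b : 'I_M -> 'X_{1..n}), [/\ (M <= N)%N, forall i, mdeg (b i) = d &
    forall f, f \is d.-homog -> span_mod I (fun i => 'X_[b i]) f].
Proof.
move=> sI [y [yd yspan]].
pose s := [seq 'X_[bmnm m] : S | m <- enum {: 'X_{1..n < d.+1}} & mdeg (bmnm m) == d].
have [M [x [xs xind xspan]]] := indep_extract s sI.
have /choice[b bP] : forall i, exists m, mdeg m = d /\ x i = 'X_[m].
  by move=> i; have /mapP[m] := xs i; rewrite mem_filter => /andP[/eqP ? _] ?; exists m.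
exists M, b; split=> [|i|f fd]; last 1 first.
- have -> : (fun i => 'X_[b i]) = x by apply/funext => i; case: (bP i).
  rewrite [f]mpolyE; apply: subspace_sum => [|m mf _]; first exact: span_mod_subspace.
  apply: subspaceZ; first exact: span_mod_subspace.
  have md : mdeg m = d by exact: (dhomog_mf fd).
  have mb : (mdeg m < d.+1)%N by rewrite md.
  apply: xspan; apply/mapP; exists (BMultinom mb) => //.
  by rewrite mem_filter /= md eqxx mem_enum.
- apply: (indep_le_span sI xind) => i; apply: yspan.
  by have [bd ->] := bP i; rewrite dhomogX; apply/eqP.
- by case: (bP i).
Qed.

(** * Leading forms for a weight *)

Section Degeneration.
Variable wt : measure n.

Lemma mcoeff_pihomog (mf : measure n) d f m :
  (pihomog mf d f)@_m = if mf m == d then f@_m else 0.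
Proof.
rewrite pihomogE raddf_sum /= big_mkcond /=.
under eq_bigr => m' _ do rewrite mcoeffZ mcoeffX.
case: (boolP (m \in msupp f)) => fm; last first.
  rewrite -mcoeff_eq0 in fm; rewrite (eqP fm) if_same big1_seq // => m' /= fm'.
  case: ifP => // _; have [mm|] := eqVneq m' m; last by rewrite mulr0.
  by move: fm'; rewrite mm mcoeff_msupp fm.
rewrite (bigD1_seq m) //= eqxx mulr1 big1 ?addr0 // => m' /negPf ->.
by rewrite mulr0 if_same.
Qed.

Lemma pihomogM (mf : measure n) d e h g : g \is e.-homog for mf ->
  pihomog mf d (h * g) = if (e <= d)%N then pihomog mf (d - e) h * g else 0.
Proof.
move=> ge; rewrite [h]mpolyE mulr_suml !raddf_sum /=.
have XgE m : 'X_[m] * g \is (mf m + e).-homog for mf.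
  by apply: dhomogM => //; rewrite dhomogX.
have piE m : pihomog mf d (h@_m *: 'X_[m] * g) =
    if (mf m + e == d)%N then h@_m *: 'X_[m] * g else 0.
  rewrite -scalerAl linearZ /=; case: eqP => [<-|/eqP mfd].
    by rewrite pihomog_dE.
  by rewrite (pihomog_ne0 mfd) ?scaler0.
under eq_bigr do rewrite piE.
case: leqP => ed.
  rewrite mulr_suml; apply: eq_bigr => m _; rewrite linearZ /= pihomogX.
  rewrite -(eqn_add2r e (mf m) (d - e)) subnK //; case: ifP => // _.
  by rewrite scaler0 mul0r.
rewrite big1 // => m _; case: eqP => // mfd; move: ed.
by rewrite -mfd ltnNge leq_addl.
Qed.

Lemma pihomog_homog (mf mf' : measure n) d e f :
  f \is d.-homog for mf -> pihomog mf' e f \is d.-homog for mf.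
Proof.
move=> /dhomogP fd; apply/dhomogP => m; rewrite mcoeff_msupp mcoeff_pihomog.
by case: ifP => _; rewrite ?eqxx // -mcoeff_msupp => /fd.
Qed.

Definition lower d w f : Prop :=
  f \is d.-homog /\ forall m, m \in msupp f -> (wt m < w)%N.

Lemma lower_subspace d w : subspace (lower d w).
Proof.
split=> [|a u v [ud uw] [vd vw]].
  by split=> [|m]; rewrite ?dhomog0 ?msupp0.
split; first by apply: dhomogD => //; apply: dhomogZ.
move=> m /msuppD_le; rewrite mem_cat => /orP[/msuppZ_le/uw|/vw] //.
Qed.

Lemma lowerM d w e v h f : h \is d.-homog -> h \is w.-homog for wt ->
  lower e v f -> lower (d + e) (w + v) (h * f).
Proof.
move=> hd /dhomogP hw [fe fv]; split; first exact: dhomogM.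
move=> m /msuppM_le/allpairsP[[m1 m2] /= [/hw m1w /fv m2v ->]].
by rewrite mfD m1w ltn_add2l.
Qed.

Definition bihomog d w f : S := pihomog wt w (pihomog mdeg d f).

(* Replacing the generators of a bihomogeneous ideal by elements with these
   leading forms can only decrease the Hilbert function. *)
Lemma hilbert_le_degenerate G I d N : ideal I ->
  (forall g, G g -> exists e w v, [/\ g \is e.-homog, g \is w.-homog for wt,
     I v & lower e w (g - v)]) ->
  hilbert_le (idl G) d N -> exists2 M, (M <= N)%N & hilbert_le I d M.
Proof.
move=> iI GI; have sI := ideal_subspace iI; have sG := ideal_subspace (idl_ideal G).
case/(hilbert_le_monomial sG) => M [b [MN bd bspan]]; exists M => //.
exists (fun i => 'X_[b i]); split=> [i|f fd]; first by rewrite dhomogX; apply/eqP/bd.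
(* Each bihomogeneous component of an element of [idl G] agrees up to lower weight with an element
   of [I]: a generator is multiplied by a bihomogeneous piece of its cofactor, so that degrees and
   weights add exactly. *)
have lead f' : idl G f' -> forall e w, exists2 f'', I f'' &
    lower e w (bihomog e w f' - f'').
  elim=> [|h g f0 /GI[d0 [w0 [v [gd gw Iv gv]]]] _ IH] e w.
    exists 0; first by case: iI.
    rewrite /bihomog !pihomog0 subr0; by case: (lower_subspace e w).
  have [f1 If1 lf1] := IH e w; rewrite /bihomog !raddfD /= (pihomogM _ _ gd).
  case: leqP => [de|_]; last by exists f1; rewrite // pihomog0 add0r.
  rewrite (pihomogM _ _ gw); case: leqP => [dw|_]; last by exists f1; rewrite // add0r.
  set k := pihomog _ _ (pihomog _ _ h).
  exists (k * v + f1); first by case: iI => _; apply.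
  rewrite opprD addrACA -mulrBr; apply: subspaceD => //; first exact: lower_subspace.
  rewrite -{1}(subnK de) -{1}(subnK dw); apply: lowerM => //.
    by apply: pihomog_homog; apply: pihomogP.
  exact: pihomogP.
have sb := span_mod_subspace (fun i => 'X_[b i]) sI.
(* Induction on a bound for the weight: each monomial is rewritten modulo [I] through the monomials
   [b], with an error of smaller weight. *)
suff low w : forall f, lower d w f -> span_mod I (fun i => 'X_[b i]) f.
  apply: (low (\max_(m <- msupp f) (wt m).+1)%N); split=> // m mf.
  by rewrite (big_rem m) //= leq_max ltnSn.
elim/ltn_ind: w => w IH {fd}f [/dhomogP fd fw]; rewrite [f]mpolyE.
apply: subspace_sum => // m mf _; apply: subspaceZ => //.
have md : ('X_[m] : S) \is d.-homog by rewrite dhomogX; apply/eqP/fd.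
have [c Ic] := bspan _ md.
have [f1 If1] := lead _ Ic d (wt m); set r := bihomog _ _ _ => lf1.
have {lf1} := IH _ (fw _ mf) _ lf1; set k := r - f1 => kspan.
(* The component of weight [wt m] of the relation for ['X_[m]] discards the ['X_[b i]] of other
   weights. *)
have rE : r = 'X_[m] - \sum_i (c i *+ (wt (b i) == wt m)) *: 'X_[b i].
  rewrite /r /bihomog pihomogB (pihomog_dE md) pihomogB pihomogX eqxx.
  congr (_ - _).
  rewrite (raddf_sum (pihomog mdeg d)) (raddf_sum (pihomog wt (wt m))) /=; apply: eq_bigr => i _.
  rewrite !linearZ /= [pihomog mdeg _ _]pihomog_dE; last by rewrite dhomogX; apply/eqP/bd.
  by rewrite pihomogX; case: (_ == _); rewrite ?scale0r ?scaler0.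
rewrite (_ : 'X_[m] = k + (f1 + \sum_i (c i *+ (wt (b i) == wt m)) *: 'X_[b i])).
  apply: subspaceD => //; apply: subspaceD => //; first exact: span_mod_sub.
  by apply: subspace_sum => // i _ _; apply: subspaceZ => //; apply: span_mod_gen.
by rewrite addrA /k subrK rE subrK.
Qed.

End Degeneration.
End Ideals.

(** * Chains of homogeneous primes *)

Section HomogeneousPrimes.
Variables (F : fieldType) (n : nat).
Local Notation S := {mpoly F[n]}.
Implicit Types (I p q : S -> Prop) (f g h : S).

Definition homogeneous_prime p : Prop :=
  [/\ ideal p, forall f d, p f -> p (pihomog mdeg d f), ~ p 1 &
      forall f g, p (f * g) -> p f \/ p g].

Lemma primeX p f k : homogeneous_prime p -> p (f ^+ k) -> p f.
Proof.
move=> [_ _ p1 pM]; elim: k => [|k IH]; first by rewrite expr0.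
by rewrite exprS => /pM[|/IH].
Qed.

Lemma hilbert_ge_leq I d N M : (N <= M)%N -> hilbert_ge I d M -> hilbert_ge I d N.
Proof.
move=> NM [x [xd xind]]; exists (x \o widen_ord NM); split=> [i|c Ic i]; first exact: xd.
pose c' (j : 'I_M) := oapp c 0 (insub (val j)).
have cE j : c' (widen_ord NM j) = c j by rewrite /c' /= valK.
rewrite -cE; apply: xind; rewrite (bigID (fun j : 'I_M => (j < N)%N)) /=.
rewrite (big_ord_narrow NM) /= [X in _ + X]big1 ?addr0 => [|j /negPf jN].
  by under eq_bigr do rewrite cE.
by rewrite /c' insubF // scale0r.
Qed.

(** As [p] is prime, multiplication by [f] keeps the [x j] independent modulo [p], and the products
    lie in [q]. So a relation between these products and the [y j], read modulo [q], first loses its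
    [y] part. *)
Lemma hilbert_ge_prime_step p q f s d N M :
  homogeneous_prime p -> ideal q -> (forall g, p g -> q g) ->
  q f -> ~ p f -> f \is s.-homog ->
  hilbert_ge p d N -> hilbert_ge q (s + d) M -> hilbert_ge p (s + d) (N + M).
Proof.
move=> [ip _ _ pM] iq pq qf pf fs [x [xd xind]] [y [yd yind]].
pose z i := match split i with inl j => f * x j | inr j => y j end.
have zl j : z (lshift M j) = f * x j by rewrite /z (unsplitK (inl j)).
have zr j : z (rshift N j) = y j by rewrite /z (unsplitK (inr j)).
exists z; split=> [i|c].
  by rewrite /z; case: (split i) => j; [apply: dhomogM|].
rewrite big_split_ord /=; under eq_bigr do rewrite zl; under [X in _ + X]eq_bigr do rewrite zr.
move=> pc; have sp := ideal_subspace ip; have sq := ideal_subspace iq.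
have fE : \sum_i c (lshift M i) *: (f * x i) = f * \sum_i c (lshift M i) *: x i.
  by rewrite mulr_sumr; apply: eq_bigr => i _; rewrite scalerAr.
have c_r j : c (rshift N j) = 0.
  apply: (yind (fun j => c (rshift N j))); set t := \sum_j _.
  rewrite -[t](addKr (\sum_i c (lshift M i) *: (f * x i))) addrC.
  apply: subspaceB => //; first exact: pq.
  by rewrite fE mulrC; apply: idealM.
have {}pc : p (f * \sum_i c (lshift M i) *: x i).
  rewrite -fE; rewrite [X in _ + X]big1 ?addr0 in pc => // j _.
  by rewrite c_r scale0r.
have c_l : forall j, c (lshift M j) = 0.
  by case/pM: pc => // /(xind (fun j => c (lshift M j))).
by move=> i; rewrite -(splitK i); case: (split i) => j /=.
Qed.

Lemma prime_separating_homog p q : homogeneous_prime p -> homogeneous_prime q ->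
  (exists f, q f /\ ~ p f) -> exists d f, [/\ f \is d.-homog, q f & ~ p f].
Proof.
move=> [ip _ _ _] [_ hq _ _] [f [qf pf]]; apply: contrapT => hf; apply: pf.
rewrite (@pihomog_partitionE _ _ mdeg _ _ (leqnn (msize f))).
apply: subspace_sum => [|d _ _]; first exact: ideal_subspace.
apply: contrapT => pfd; apply: hf; exists d, (pihomog mdeg d f); split=> //.
  exact: pihomogP.
exact: hq.
Qed.

Lemma hilbert_ge_prime1 p d f : homogeneous_prime p -> f \is d.-homog -> ~ p f ->
  hilbert_ge p d 1.
Proof.
move=> [ip _ _ _] fd pf; exists (fun=> f); split=> // c.
rewrite big_ord1 => pcf i; rewrite (ord1 i); apply/eqP; apply: contra_notT pf => c0.
rewrite -[f]scale1r -(mulVf c0) -scalerA; apply: subspaceZ => //.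
exact: ideal_subspace.
Qed.

(* Multiplication by a form of degree [s] in [q i] but not in [q i.+1] gives
   H(q i.+1, d + s) >= H(q i.+1, d) + H(q i, d + s). *)
Lemma hilbert_ge_chain (q : nat -> S -> Prop) l :
  (forall i, (i <= l)%N -> homogeneous_prime (q i)) -> (exists i, ~ q 0 'X_i) ->
  (forall i, (i < l)%N ->
     (forall f, q i.+1 f -> q i f) /\ exists f, q i f /\ ~ q i.+1 f) ->
  exists2 t, (0 < t)%N & forall d, hilbert_ge (q l) (t * d) 'C(d + l, l).
Proof.
move=> qp [i0 qi0] qS.
suff [] : ~ q l 'X_i0 /\
  exists2 t, (0 < t)%N & forall d, hilbert_ge (q l) (t * d) 'C(d + l, l) by [].
have X1 : ('X_i0 : S) \is 1.-homog by rewrite dhomogX; apply/eqP/mdeg1.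
elim: l qp qS => [|l IH] qp qS.
  split=> //; exists 1%N => // d; rewrite addn0 bin0.
  apply: (@hilbert_ge_prime1 _ _ ('X_i0 ^+ d)) (dhomogMn _ X1) _; first exact: qp.
  by move=> qXd; apply/qi0/(primeX (qp 0%N _) qXd).
have [i il|i il|ql [t t0 geql]] := IH; [exact/qp/leqW|exact/qS/leqW|].
have [qlS qlf] := qS _ (ltnSn l).
have qSl : ~ q l.+1 'X_i0 by move/qlS.
split=> //; have qpl := qp _ (leqnSn l); have qpl1 := qp _ (leqnn l.+1).
have [s [f [fs qf pf]]] := prime_separating_homog qpl1 qpl qlf.
(* The factor ['X_i0] makes the degree positive, and the power [t] makes it a multiple of [t], so
   that the bound for [q l] applies in the degrees reached. *)
pose g := (f * 'X_i0) ^+ t.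
have gs : g \is (t * s.+1).-homog by rewrite mulnC -addn1; apply/dhomogMn/dhomogM.
have pg : ~ q l.+1 g.
  by move/(primeX qpl1); case: qpl1 => _ _ _ pM /pM[].
have qg : q l g.
  case: (qpl) => ip _ _ _; rewrite /g; case: (t) t0 => // t' _.
  by rewrite exprSr; apply: idealM => //; rewrite mulrC; apply: idealM.
exists (t * s.+1)%N; first by rewrite muln_gt0 t0.
elim=> [|d IHd].
  rewrite muln0 binn; apply: (@hilbert_ge_prime1 _ _ 1) => //; first exact: dhomog1.
  by case: qpl1.
(* Pascal's rule: one binomial comes from [q l.+1] in the previous degree, the other from [q l] in
   the same degree. *)
rewrite mulnS addSn binS; apply: (hilbert_ge_prime_step qpl1 _ qlS qg) => //.
  by case: qpl.
rewrite -mulnS -mulnA addnS -addSn; apply: hilbert_ge_leq (geql _).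
by rewrite leq_bin2l // leq_add2r mulSn leq_addr.
Qed.

End HomogeneousPrimes.

(** * Sections by coordinate subspaces of shifted sets *)

Section HilbertStep.
Variables (F : fieldType) (n : nat).
Local Notation S := {mpoly F[n]}.
Implicit Types (I G : S -> Prop) (f g h : S).

Lemma idl_homogeneous G : (forall g, G g -> exists e, g \is e.-homog) ->
  forall f d, idl G f -> idl G (pihomog mdeg d f).
Proof.
move=> Gh f d; have iG := idl_ideal G.
elim=> [|h g f' Gg _ IH]; first by rewrite pihomog0; case: iG.
have [e ge] := Gh _ Gg; rewrite pihomogD; apply: subspaceD => //.
  exact: ideal_subspace.
rewrite (pihomogM _ _ ge); case: leqP => _; last by case: iG.
by apply: idealM => //; apply: idl_gen.
Qed.

Lemma hilbert_le0 I : subspace I -> hilbert_le I 0 1.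
Proof.
move=> sI; exists (fun=> 1); split=> [_|f /dhomogP f0]; first exact: dhomog1.
have -> : f = f@_0%MM *: 1.
  apply/mpolyP => m; rewrite mcoeffZ mcoeff1; case: eqP => [->|/eqP m0].
    by rewrite mulr1.
  rewrite mulr0; apply: memN_msupp_eq0; apply: contra m0 => /f0 /eqP.
  by rewrite mdeg_eq0.
apply: subspaceZ; first exact: span_mod_subspace.
exact: (@span_mod_gen _ _ _ _ (fun=> 1) ord0).
Qed.

(** Here [I1] is contained in [I + (g)] and [I2] in the colon ideal [I : g]. A form is first reduced
    modulo [I1], leaving a multiple [h * g], and then [h] is reduced modulo [I2]. *)
Lemma hilbert_le_step I I1 I2 g d N M : ideal I ->
  (forall f e, I f -> I (pihomog mdeg e f)) -> g \is 1.-homog ->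
  (forall f, I1 f -> exists h f', f = h * g + f' /\ I f') ->
  (forall f, I2 f -> I (f * g)) ->
  hilbert_le I1 d.+1 N -> hilbert_le I2 d M -> hilbert_le I d.+1 (N + M).
Proof.
move=> iI hI g1 I1P I2P [x [xd xspan]] [y [yd yspan]]; have sI := ideal_subspace iI.
pose z i := match split i with inl j => x j | inr j => y j * g end.
have zl j : z (lshift M j) = x j by rewrite /z (unsplitK (inl j)).
have zr j : z (rshift N j) = y j * g by rewrite /z (unsplitK (inr j)).
exists z; split=> [i|f fd].
  by rewrite /z; case: (split i) => j //; rewrite -addn1; apply: dhomogM.
have sz := span_mod_subspace z sI.
have [c /I1P[h [f' [hf' If']]]] := xspan _ fd.
have [b I2b] := yspan _ (pihomogP mdeg d h).
have fxE : f - \sum_i c i *: x i = pihomog mdeg d h * g + pihomog mdeg d.+1 f'.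
  rewrite -[LHS](@pihomog_dE _ _ mdeg d.+1).
    by rewrite hf' pihomogD (pihomogM _ _ g1) /= subn1.
  by apply: dhomogD => //; rewrite dhomogN; apply: rpred_sum => i _; apply: dhomogZ.
rewrite -[f](subrK (\sum_i c i *: x i)) fxE.
rewrite -[pihomog mdeg d h](subrK (\sum_i b i *: y i)) mulrDl -!addrA.
apply: subspaceD => //; first by apply/span_mod_sub/I2P.
apply: subspaceD => //; last apply: subspaceD => //.
- rewrite mulr_suml; apply: subspace_sum => // i _ _.
  by rewrite -scalerAl -zr; apply: subspaceZ => //; apply: span_mod_gen.
- by apply/span_mod_sub/hI.
- apply: subspace_sum => // i _ _.
  by rewrite -zl; apply: subspaceZ => //; apply: span_mod_gen.
Qed.

End HilbertStep.

(** * Plücker relations and shifted sets of coordinates *)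

Section Pluecker.
Variables (F : fieldType) (m : nat).
Local Notation S := {mpoly F[nplucker m]}.
Implicit Types (f g h : S) (i j k l p q : 'I_m) (T : {set 'I_m * 'I_m}).

Definition plucker_pair (e : 'I_(nplucker m)) : 'I_m * 'I_m := enum_val e.

Lemma plucker_pair_inj : injective plucker_pair.
Proof. exact: enum_val_inj. Qed.

Lemma plucker_pair_lt e : ((plucker_pair e).1 < (plucker_pair e).2)%N.
Proof. by have := enum_valP e; rewrite inE. Qed.

Lemma plucker_pair_surj i j : (i < j)%N -> exists e, plucker_pair e = (i, j).
Proof.
move=> ij; have ijP : (i, j) \in plucker_index m by rewrite inE.
by exists (enum_rank_in ijP (i, j)); rewrite /plucker_pair enum_rankK_in.
Qed.

(** Coordinates for arbitrary ordered pairs, antisymmetric and zero on the diagonal, so that the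
    relations need no ordering of the indices. *)
Definition Xp i j : S := \sum_e
  ((plucker_pair e == (i, j))%:R - (plucker_pair e == (j, i))%:R) *: 'X_e.

Lemma Xp_anti i j : Xp j i = - Xp i j.
Proof. by rewrite -sumrN; apply: eq_bigr => e _; rewrite -scaleNr opprB. Qed.

Lemma Xp_diag i : Xp i i = 0.
Proof. by rewrite /Xp big1 // => e _; rewrite subrr scale0r. Qed.

Lemma Xp_pair e : Xp (plucker_pair e).1 (plucker_pair e).2 = 'X_e.
Proof.
rewrite /Xp (bigD1 e) //= -surjective_pairing eqxx.
have neq e' : (plucker_pair e' == ((plucker_pair e).2, (plucker_pair e).1)) = false.
  apply/eqP => ee'; have := plucker_pair_lt e'; have := plucker_pair_lt e.
  by rewrite ee' /= => /ltnW; rewrite leqNgt => /negPf ->.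
rewrite neq subr0 scale1r big1 ?addr0 // => e' e'e.
by rewrite neq (inj_eq plucker_pair_inj) (negPf e'e) subrr scale0r.
Qed.

Lemma Xp_dhomog i j : Xp i j \is 1.-homog.
Proof.
by apply: rpred_sum => e _; apply: dhomogZ; rewrite dhomogX; apply/eqP/mdeg1.
Qed.

Definition plucker_rel i j k l : S :=
  Xp i j * Xp k l - Xp i k * Xp j l + Xp i l * Xp j k.

Lemma plucker_rel_dhomog i j k l : plucker_rel i j k l \is 2.-homog.
Proof.
have XX i' j' k' l' : Xp i' j' * Xp k' l' \is 2.-homog.
  by rewrite -[2%N]addn1; apply: dhomogM; apply: Xp_dhomog.
by apply: dhomogD => //; apply: dhomogD => //; rewrite dhomogN.
Qed.

Definition section_gens T f : Prop :=
  (exists i j k l, f = plucker_rel i j k l) \/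
  exists2 ij, ij \notin T & f = Xp ij.1 ij.2.

(* A Pluecker coordinate is represented in [T] by both orderings of its index
   pair, so that compressions do not have to reorder pairs. *)
Definition section_ideal T : S -> Prop := idl (section_gens T).

Lemma section_ideal_rel T i j k l : section_ideal T (plucker_rel i j k l).
Proof. by apply: idl_gen; left; exists i, j, k, l. Qed.

Lemma section_ideal_Xp T i j : (i, j) \notin T -> section_ideal T (Xp i j).
Proof. by move=> ijT; apply: idl_gen; right; exists (i, j). Qed.

Lemma section_ideal_homogeneous T f d :
  section_ideal T f -> section_ideal T (pihomog mdeg d f).
Proof.
apply: idl_homogeneous => _ [[i [j [k [l ->]]]]|[ij _ ->]].
  by exists 2%N; apply: plucker_rel_dhomog.
by exists 1%N; apply: Xp_dhomog.
Qed.

(** A shifted graph in the sense of extremal combinatorics, with both orientations of each edge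
    listed. *)
Definition shifted T : Prop :=
  [/\ forall i j, (i, j) \in T -> (j, i) \in T, forall i, (i, i) \notin T &
      forall p q j, (q, j) \in T -> (p < q)%N -> p != j -> (p, j) \in T].

Definition schubert_set i j : {set 'I_m * 'I_m} :=
  [set kl : 'I_m * 'I_m | (kl.1 != kl.2) &&
    (((kl.1 <= i) && (kl.2 <= j)) || ((kl.1 <= j) && (kl.2 <= i)))%N].

Lemma schubert_set_sub T i j : shifted T -> (i < j)%N -> (i, j) \in T ->
  schubert_set i j \subset T.
Proof.
move=> [sT _ dT] ij ijT.
suff sub k l : k != l -> (k <= i)%N -> (l <= j)%N -> (k, l) \in T.
  apply/fintype.subsetP => -[k l]; rewrite inE /= => /andP[kl /orP[]/andP[]]; first exact: sub.
  by move=> kj li; apply: sT; apply: sub => //; rewrite eq_sym.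
move=> kl ki lj; have kj : (k, j) \in T.
  have [ltki|] := ltnP k i.
    by apply: dT ijT _ _ => //; rewrite -val_eqE /= ltn_eqF // (leq_ltn_trans ki).
  by move=> ik; have -> : k = i by apply/val_inj/eqP; rewrite eqn_leq ki.
have [ltlj|jl] := ltnP l j; last first.
  by have -> : l = j by apply/val_inj/eqP; rewrite eqn_leq lj.
by apply/sT/(dT _ j) => //; [apply: sT|rewrite eq_sym].
Qed.

Lemma schubert_set_shifted i j : (i < j)%N -> shifted (schubert_set i j).
Proof.
move=> ij; split=> [k l|k|p q k].
- by rewrite !inE /= eq_sym orbC ![((l <= _) && _)%N]andbC.
- by rewrite inE eqxx.
- rewrite !inE /= => /andP[_ qk] pq ->/=; move: qk; have := ltn_ord q; lia.
Qed.

Lemma shifted_top T : shifted T -> T != finset.set0 -> exists i j,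
  [/\ (i < j)%N, (i, j) \in T, forall k l, (k, l) \in T -> (k <= j)%N &
      forall k, (k, j) \in T -> (k <= i)%N].
Proof.
move=> [sT iT _] /finset.set0Pn[x0 x0T].
(* The objective orders pairs lexicographically, second index first. *)
case: (arg_maxnP (fun x : 'I_m * 'I_m => (x.2 * m + x.1)%N) x0T) => -[i j] /= ijT max_ij.
have {}ijT : (i, j) \in T by [].
have lej k l : (k, l) \in T -> (l <= j)%N.
  move=> klT; have := max_ij _ klT; rewrite /= => le_kl; rewrite -ltnS.
  rewrite -(@ltn_pmul2r m) ?(leq_ltn_trans _ (ltn_ord i)) //.
  by rewrite mulSn (leq_ltn_trans (leq_addr k _)) // (leq_ltn_trans le_kl) // addnC ltn_add2r.
exists i, j; split=> // [|k l /sT/lej //|k /max_ij /=]; last by rewrite leq_add2l.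
have := lej _ _ (sT _ _ ijT); rewrite leq_eqVlt => /predU1P[/val_inj ji|//].
by move: ijT; rewrite ji (negPf (iT _)).
Qed.

Lemma shifted_rem_top T i j : shifted T -> (i < j)%N ->
  (forall k l, (k, l) \in T -> (k <= j)%N) -> (forall k, (k, j) \in T -> (k <= i)%N) ->
  shifted (T :\ (i, j) :\ (j, i)).
Proof.
move=> [sT iT dT] ij lej lei; split=> [k l|k|p q k].
- rewrite !inE !xpair_eqE => /and3P[kl1 kl2 /sT ->]; rewrite andbT.
  by rewrite ![(l == _) && _]andbC kl1 kl2.
- by rewrite !inE (negPf (iT k)) !andbF.
- rewrite !inE => /and3P[_ _ qk] pq pk; rewrite (dT _ _ _ qk pq pk) andbT !xpair_eqE.
  apply/andP; split; apply/negP => /andP[/eqP pE /eqP kE]; subst p k.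
    by have := lej _ _ qk; rewrite leqNgt pq.
  by have := lei _ qk; rewrite leqNgt pq.
Qed.

Lemma section_ideal_rem T i j f : section_ideal (T :\ (i, j) :\ (j, i)) f ->
  exists h f', f = h * Xp i j + f' /\ section_ideal T f'.
Proof.
have iT := idl_ideal (section_gens T); have [T0 TD] := iT.
move: f; refine (idl_sub _ _) => [|_ [[k [l [k' [l' ->]]]]|[[k l] klT ->]]] //=.
- split=> [|h _ _ [h1 [f1 [-> Tf1]]] [h2 [f2 [-> Tf2]]]].
    by exists 0, 0; rewrite mul0r addr0.
  exists (h * h1 + h2), (h * f1 + f2); split; last exact: TD.
  by ring.
- exists 0; eexists; split; last exact: (section_ideal_rel T k l k' l').
  by rewrite mul0r add0r.
- move: klT; rewrite !inE; case: eqP => [[-> ->] _|_]; last case: eqP => [[-> ->] _|_ klT].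
  + by exists (-1), 0; rewrite Xp_anti mulN1r addr0.
  + by exists 1, 0; rewrite mul1r addr0.
  + by exists 0, (Xp k l); rewrite mul0r add0r; split=> //; apply: section_ideal_Xp.
Qed.

(* For [i < k < l < j] the Pluecker relation reads
   X_ij X_kl = X_ik X_jl - X_il X_jk, whose right hand side vanishes. *)
Lemma section_ideal_top T i j f : shifted T -> (i < j)%N ->
  (forall k l, (k, l) \in T -> (k <= j)%N) -> (forall k, (k, j) \in T -> (k <= i)%N) ->
  section_ideal (schubert_set i j) f -> section_ideal T (f * Xp i j).
Proof.
move=> [sT iT dT] ij lej lei; have idT := idl_ideal (section_gens T).
move: f; refine (idl_sub _ _) => [|_ [[k [l [k' [l' ->]]]]|[[k l] klS ->]]] //=.
- split=> [|h u v Tu Tv]; first by rewrite mul0r; case: idT.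
  by rewrite mulrDl -mulrA; case: idT => _; apply.
- by rewrite mulrC; apply: idealM => //; apply: section_ideal_rel.
- have [klT|klT] := boolP ((k, l) \in T); last first.
    by rewrite mulrC; apply: idealM => //; apply: section_ideal_Xp.
  have kl : k != l by apply: contraTneq klT => ->; apply: iT.
  have kj := lej _ _ klT; have lj := lej _ _ (sT _ _ klT).
  have [ik il] : (i < k)%N /\ (i < l)%N.
    by move: klS; rewrite inE /= kl /= kj lj andbT /= negb_or !ltnNge => /andP[].
  have nT (x : 'I_m) : (i < x)%N -> (j, x) \notin T.
    by move=> ix; apply/negP => /sT/lei; rewrite leqNgt ix.
  rewrite (_ : _ * _ = plucker_rel i j k l + (Xp i k * Xp j l - Xp i l * Xp j k)).
    apply: subspaceD; [exact: ideal_subspace|exact: section_ideal_rel|].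
    apply: subspaceB; first exact: ideal_subspace.
      by apply: idealM => //; apply: section_ideal_Xp; apply: nT.
    by apply: idealM => //; apply: section_ideal_Xp; apply: nT.
  by rewrite /plucker_rel; ring.
Qed.

Lemma hilbert_le_empty d : hilbert_le (section_ideal finset.set0) d.+1 0.
Proof.
exists (fun=> 0); split=> [[]//|f /dhomogP fd]; exists (fun=> 0); rewrite big_ord0 subr0.
have iT := idl_ideal (section_gens finset.set0).
rewrite [f]mpolyE; apply: subspace_sum => [|x /fd xd _]; first exact: ideal_subspace.
apply: subspaceZ; first exact: ideal_subspace.
have [e xe] : exists e, x e != 0%N.
  apply/existsP; apply: contraT => /existsPn x0; move: xd; rewrite /= mdegE big1 // => e _.
  by apply/eqP; have := x0 e; rewrite negbK.
rewrite -(submK (m := U_(e)) (m' := x)); last first.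
  by rewrite lep1mP.
rewrite mpolyXD; apply: idealM => //; rewrite -Xp_pair.
by apply: section_ideal_Xp; rewrite inE.
Qed.

Lemma leq_exp_base a b e : (a <= b)%N -> (a ^ e <= b ^ e)%N.
Proof. by case: e => // e ab; rewrite leq_exp2r. Qed.

(** Induction on the size of [T], removing its top pair [(i, j)]. The colon ideal contains that of
    [schubert_set i j]; if this set is smaller than [T], both summands are covered by induction.
    Otherwise degree [d.+1] of [T] is compared with degree [d] of [T] itself, and summation raises
    the exponent by one. *)
Lemma hilbert_le_shifted T D : shifted T ->
  (forall i j, (i, j) \in T -> (i + j <= D.+1)%N) ->
  exists c, forall d, exists2 N, (N <= c * d.+1 ^ D)%N & hilbert_le (section_ideal T) d N.
Proof.
have [n] := ubnP #|T|; elim: n => // n IH in T D * => Tn sT rT.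
have iT := idl_ideal (section_gens T).
have H0 : hilbert_le (section_ideal T) 0 1 by apply/hilbert_le0/ideal_subspace.
have [T0|Tn0] := eqVneq T finset.set0.
  exists 1%N => -[|d]; first by exists 1%N; rewrite ?exp1n.
  by exists 0%N => //; rewrite T0; apply: hilbert_le_empty.
have [i [j [ij ijT lej lei]]] := shifted_top sT Tn0.
pose T' := T :\ (i, j) :\ (j, i).
have sT' : shifted T' by apply: shifted_rem_top.
have cT' : (#|T'| < #|T|)%N.
  apply: proper_card; apply/properP; split.
    by apply/fintype.subsetP => x; rewrite !inE => /and3P[].
  by exists (i, j) => //; rewrite !inE eqxx andbF.
have step d N M : hilbert_le (section_ideal T') d.+1 N ->
    hilbert_le (section_ideal (schubert_set i j)) d M ->
    hilbert_le (section_ideal T) d.+1 (N + M).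
  apply: hilbert_le_step (Xp_dhomog i j) _ _ => //.
  - by move=> f e; apply: section_ideal_homogeneous.
  - by move=> f; apply: section_ideal_rem.
  - by move=> f; apply: section_ideal_top.
have subT := schubert_set_sub sT ij ijT.
have [eqT|neqT] := eqVneq (schubert_set i j) T; last first.
  have [|c1 Hc1] := IH T' D (leq_trans cT' Tn) sT'.
    by move=> k l; rewrite !inE => /and3P[_ _]; apply: rT.
  have cS : (#|schubert_set i j| < n)%N.
    rewrite -ltnS; apply: leq_trans Tn; rewrite ltnS.
    by apply: proper_card; rewrite finset.properEneq neqT.
  have [|c2 Hc2] := IH _ D cS (schubert_set_shifted ij).
    by move=> k l /(fintype.subsetP subT); apply: rT.
  exists (c1 + c2 + 1)%N => -[|d]; first by exists 1%N; rewrite // exp1n muln1 addn1.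
  have [N NP HN] := Hc1 d.+1; have [M MP HM] := Hc2 d.
  exists (N + M)%N; last exact: step.
  rewrite !mulnDl (leq_trans _ (leq_addr _ _)) // leq_add // (leq_trans MP) //.
  by rewrite leq_mul2l leq_exp_base ?orbT.
rewrite eqT in step.
case: D rT => [|D] rT.
  (* Distinct indices with sum at most one can only be 0 and 1. *)
  have T'0 : T' = finset.set0.
    apply/finset.setP => -[k l]; rewrite !inE !xpair_eqE; apply/negP => /and3P[kl1 kl2 klT].
    have := rT _ _ klT; have := rT _ _ ijT; have : k != l.
      by apply: contraTneq klT => ->; case: sT.
    by move: kl1 kl2; rewrite -!val_eqE /=; lia.
  exists 1%N => d; rewrite expn0; exists 1%N => //; elim: d => // d Hd.
  by rewrite -[1%N]add0n; apply: step => //; rewrite T'0; apply: hilbert_le_empty.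
(* In a Schubert set the sum [i + j] is attained only at the top pair and its reverse, so the
   exponent for [T'] drops by one. *)
have [|c Hc] := IH T' D (leq_trans cT' Tn) sT'.
  move=> k l; rewrite !inE !xpair_eqE -eqT inE => /and4P[kl1 kl2 _ klS].
  by have := rT _ _ ijT; move: kl1 kl2 klS; rewrite -!val_eqE /=; lia.
exists c.+1; elim=> [|d [N NP HN]]; first by exists 1%N; rewrite // exp1n muln1.
have [M MP HM] := Hc d.+1.
exists (M + N)%N; last exact: step.
have : (d.+1 ^ D <= d.+2 ^ D)%N by exact: leq_exp_base.
by move: NP MP; rewrite !expnS; nia.
Qed.

End Pluecker.

(** * Weights and compressions *)

Section Weights.
Variable m : nat.

(** The torus weights [2 ^ i] on the basis vectors make the Plücker relations homogeneous, and
    uniqueness of binary expansions separates the coordinates. *)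
Definition plucker_weight (x : 'X_{1..nplucker m}) : nat :=
  \sum_e x e * (2 ^ (plucker_pair e).1 + 2 ^ (plucker_pair e).2).

Lemma plucker_weight0 : plucker_weight 0%MM = 0%N.
Proof. by rewrite /plucker_weight big1 // => e _; rewrite mnmE. Qed.

Lemma plucker_weightD : {morph plucker_weight : x y / (x + y)%MM >-> (x + y)%N}.
Proof.
move=> x y; rewrite /plucker_weight -big_split /=; apply: eq_bigr => e _.
by rewrite mnmE mulnDl.
Qed.

HB.instance Definition _ :=
  isMeasure.Build (nplucker m) plucker_weight plucker_weight0 plucker_weightD.

Lemma plucker_weight1 e :
  plucker_weight U_(e) = (2 ^ (plucker_pair e).1 + 2 ^ (plucker_pair e).2)%N.
Proof.
rewrite /plucker_weight (bigD1 e) //= mnmE eqxx mul1n big1 ?addn0 // => e' e'e.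
by rewrite mnmE eq_sym (negPf e'e).
Qed.

Lemma plucker_weight1_inj : injective (fun e => plucker_weight U_(e)).
Proof.
move=> e f /=; rewrite !plucker_weight1.
have := plucker_pair_lt e; have := plucker_pair_lt f.
case Ee: (plucker_pair e) => [i j]; case Ef: (plucker_pair f) => [k l] /= kl ij.
have lt a b c d : (a < b)%N -> (b < d)%N -> (2 ^ a + 2 ^ b < 2 ^ c + 2 ^ d)%N.
  move=> ab bd; have : (2 ^ a < 2 ^ b)%N by rewrite ltn_exp2l.
  have : (2 ^ b.+1 <= 2 ^ d)%N by rewrite leq_exp2l.
  by rewrite expnS; lia.
move=> ww; have jl : j = l :> nat.
  case: (ltngtP j l) => // [jl|lj].
    by have := lt i j k l ij jl; rewrite ww ltnn.
  by have := lt k l i j kl lj; rewrite ww ltnn.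
have ik : i = k :> nat by move/eqP: ww; rewrite jl eqn_add2r eqn_exp2l // => /eqP.
by apply: plucker_pair_inj; rewrite Ee Ef; congr (_, _); apply: val_inj.
Qed.

End Weights.

Section Morphisms.
Variables (F : fieldType) (n : nat).

Lemma mpoly_rmorphism_ext (R : nzRingType) (phi psi : {rmorphism {mpoly F[n]} -> R}) :
  (forall c, phi c%:MP = psi c%:MP) -> (forall i, phi 'X_i = psi 'X_i) -> phi =1 psi.
Proof.
move=> eqC eqX; elim/mpolyind => [|c x f _ _ IH]; first by rewrite !raddf0.
rewrite !raddfD /= IH -mul_mpolyC !rmorphM /= eqC; congr (_ * _ + _).
rewrite mpolyXE_id !rmorph_prod /=; apply: eq_bigr => i _.
by rewrite !rmorphXn /= eqX.
Qed.

Lemma comp_mpoly_dhomog k (t : n.-tuple {mpoly F[k]}) (f : {mpoly F[n]}) d e :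
  (forall i, tnth t i \is e.-homog) -> f \is d.-homog -> f \mPo t \is (e * d).-homog.
Proof.
move=> te /dhomogP fd; rewrite comp_mpolyEX big_seq; apply: rpred_sum => x /fd <-.
apply: dhomogZ; rewrite comp_mpolyX /= mdegE big_distrr /=.
elim/big_rec2: _ => [|i y z _ zy]; first exact: dhomog1.
by apply: dhomogM => //; apply: dhomogMn.
Qed.

End Morphisms.

Section Shifting.
Variables (F : fieldType) (m : nat).
Local Notation S := {mpoly F[nplucker m]}.
Implicit Types (f g h : S) (i j k l p q : 'I_m) (T : {set 'I_m * 'I_m}).
Local Notation Xp := (Xp F).
Local Notation wt := (plucker_weight (m := m)).
Local Notation section_ideal := (section_ideal (F := F)).

Lemma Xp_weight i j : Xp i j \is (2 ^ i + 2 ^ j).-homog for wt.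
Proof.
apply: rpred_sum => e _; case: eqP => [eij|_]; last case: eqP => [eij|_].
- by apply: dhomogZ; rewrite dhomogX; apply/eqP; rewrite /= plucker_weight1 eij.
- by apply: dhomogZ; rewrite dhomogX; apply/eqP; rewrite /= plucker_weight1 eij addnC.
- by rewrite subrr scale0r dhomog0.
Qed.

Lemma Xp_lower i j w : (2 ^ i + 2 ^ j < w)%N -> lower wt 1 w (Xp i j).
Proof.
move=> ijw; split=> [|x /(dhomog_mf (Xp_weight i j)) -> //].
exact: Xp_dhomog.
Qed.

Lemma plucker_rel_weight i j k l :
  plucker_rel F i j k l \is (2 ^ i + 2 ^ j + (2 ^ k + 2 ^ l)).-homog for wt.
Proof.
have XX (a b c d : 'I_m) w : w = (2 ^ a + 2 ^ b + (2 ^ c + 2 ^ d))%N ->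
    Xp a b * Xp c d \is w.-homog for wt.
  by move=> ->; apply: dhomogM; apply: Xp_weight.
apply: dhomogD; last by apply: XX; ring.
by apply: dhomogD; [|rewrite dhomogN]; apply: XX; ring.
Qed.

(** Plücker relations are homogeneous for the weight, hence their own leading forms; only the
    coordinates outside [T] have to be realised as leading terms. *)
Lemma hilbert_le_plucker_degenerate T (I : S -> Prop) d N : ideal I ->
  (forall i j k l, I (plucker_rel F i j k l)) ->
  (forall i j, (i, j) \notin T -> exists2 v, I v & lower wt 1 (2 ^ i + 2 ^ j) (Xp i j - v)) ->
  hilbert_le (section_ideal T) d N -> exists2 M, (M <= N)%N & hilbert_le I d M.
Proof.
move=> iI Irel IX; apply: (hilbert_le_degenerate (wt := wt)) => // g.
case=> [[i [j [k [l ->]]]]|[[i j] /IX[v Iv lv] ->]].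
  exists 2%N, (2 ^ i + 2 ^ j + (2 ^ k + 2 ^ l))%N, (plucker_rel F i j k l).
  rewrite subrr; split=> //; first exact: plucker_rel_dhomog.
    exact: plucker_rel_weight.
  by case: (lower_subspace F wt 2 (2 ^ i + 2 ^ j + (2 ^ k + 2 ^ l))).
exists 1%N, (2 ^ i + 2 ^ j)%N, v; split=> //; first exact: Xp_dhomog.
exact: Xp_weight.
Qed.

Section Transvection.
Variables (p q : 'I_m) (pq : p != q).

Definition transv_coef (a : F) i : S := if i == p then a%:MP else 0.

(** The minor after the column operation; its term bilinear in the coefficients would carry
    [Xp q q = 0]. *)
Definition transv_Xp a i j : S :=
  Xp i j + transv_coef a i * Xp q j + transv_coef a j * Xp i q.

(* The action of the column operation adding [a] times column [q] to column [p]. *)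
Definition transv a : S -> S := comp_mpoly
  [tuple transv_Xp a (plucker_pair e).1 (plucker_pair e).2 | e < nplucker m].

HB.instance Definition _ a := GRing.LRMorphism.copy (transv a) (comp_mpoly
  [tuple transv_Xp a (plucker_pair e).1 (plucker_pair e).2 | e < nplucker m]).

Lemma transvXp a i j : transv a (Xp i j) = transv_Xp a i j.
Proof.
have lt k l : (k < l)%N -> transv a (Xp k l) = transv_Xp a k l.
  move=> /plucker_pair_surj[e ekl]; have := Xp_pair F e; rewrite ekl /= => ->.
  by rewrite /transv comp_mpolyXU -tnth_nth tnth_mktuple ekl.
case: (ltngtP i j) => [/lt //|ji|/val_inj ->].
  rewrite Xp_anti raddfN /= (lt _ _ ji) /transv_Xp (Xp_anti F j i) (Xp_anti F q i) (Xp_anti F j q).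
  by rewrite !mulrN; ring.
rewrite /transv_Xp Xp_diag raddf0 (Xp_anti F q j); ring.
Qed.

(** A Plücker relation is multilinear and alternating in its four indices, so substituting [q] in
    two places at once contributes nothing. *)
Lemma transv_rel T a i j k l : section_ideal T (transv a (plucker_rel F i j k l)).
Proof.
have iT := idl_ideal (section_gens (F := F) T); have sT := ideal_subspace iT.
have R i' j' k' l' := section_ideal_rel F T i' j' k' l'.
pose c := transv_coef a; pose R' := @plucker_rel F m.
rewrite (_ : transv a _ = R' i j k l + c i * R' q j k l + c j * R' i q k l
    + c k * R' i j q l + c l * R' i j k q).
  by do !apply: subspaceD => //; apply: idealM.
rewrite /plucker_rel raddfD raddfB /= !rmorphM /= !transvXp /transv_Xp -/c /R' /plucker_rel.
rewrite (Xp_anti F q i) (Xp_anti F q j) (Xp_anti F q k); ring.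
Qed.

Lemma transvK a f : transv a (transv (- a) f) = f.
Proof.
have Xe e : transv a (transv (- a) 'X_e) = 'X_e.
  rewrite -Xp_pair transvXp; case: (plucker_pair e) => i j /=.
  rewrite {1}/transv_Xp !raddfD /= !rmorphM /= !transvXp /transv_Xp.
  have cN k : transv a (transv_coef (- a) k) = - transv_coef a k.
    by rewrite /transv_coef; case: eqP => _;
      rewrite /transv ?comp_mpolyC ?raddf0 ?oppr0 // mpolyCN.
  rewrite !cN; have -> : transv_coef a q = 0 by rewrite /transv_coef eq_sym (negPf pq).
  by rewrite Xp_diag; ring.
apply: (mpoly_rmorphism_ext (phi := transv a \o transv (- a)) (psi := idfun)) => [c|e] /=.
  by rewrite /transv !comp_mpolyC.
exact: Xe.
Qed.

Lemma transv_dhomog a f d : f \is d.-homog -> transv a f \is d.-homog.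
Proof.
move=> fd; rewrite -[d]mul1n; apply: comp_mpoly_dhomog fd => e; rewrite tnth_mktuple.
have c_hom k g : g \is 1.-homog -> transv_coef a k * g \is 1.-homog.
  move=> g1; rewrite /transv_coef; case: eqP => _; last by rewrite mul0r dhomog0.
  by rewrite mul_mpolyC dhomogZ.
by do 2?[apply: dhomogD]; try apply: c_hom; apply: Xp_dhomog.
Qed.

Lemma transv_ideal T : ideal (fun f => section_ideal T (transv (- 1) f)).
Proof.
have [T0 TD] := idl_ideal (section_gens (F := F) T); split=> [|h u v Tu Tv].
  by rewrite raddf0.
by rewrite raddfD /= rmorphM; apply: TD.
Qed.

Lemma hilbert_le_transv T d N :
  hilbert_le (fun f => section_ideal T (transv (- 1) f)) d N ->
  hilbert_le (section_ideal T) d N.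
Proof.
move=> [y [yd yspan]]; exists (fun e : 'I_N => transv (- 1) (y e)).
split=> [e|f fd]; first exact: transv_dhomog.
have [c Hc] := yspan _ (transv_dhomog 1 fd); exists c.
have := transvK (- 1) f; rewrite opprK => fE; move: Hc.
have cE : transv (- 1) (\sum_e c e *: y e) = \sum_e c e *: transv (- 1) (y e).
  by rewrite (raddf_sum (transv (- 1))); apply: eq_bigr => e _; apply: comp_mpolyZ.
by rewrite raddfB /= fE cE.
Qed.

End Transvection.

Lemma sum_imset_le (A B : finType) (h : A -> B) (D : {set A}) (f : B -> nat) :
  (\sum_(y in h @: D) f y <= \sum_(x in D) f (h x))%N.
Proof.
rewrite (partition_big_imset h) /=; apply: leq_sum => y /imsetP[x xD ->].
by rewrite (bigD1 x) /= ?xD ?eqxx // leq_addr.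
Qed.

Section Compression.
Variables (T : {set 'I_m * 'I_m}) (p q : 'I_m) (pq : (p < q)%N).
Hypotheses (sT : forall i j, (i, j) \in T -> (j, i) \in T)
  (iT : forall i, (i, i) \notin T).

(** As in the shifting of set families, [q] is replaced by [p] unless the result is diagonal or
    already in [T]. *)
Definition compress_pair (x : 'I_m * 'I_m) : 'I_m * 'I_m :=
  if [&& x.1 == q, x.2 != p & (p, x.2) \notin T] then (p, x.2)
  else if [&& x.2 == q, x.1 != p & (x.1, p) \notin T] then (x.1, p) else x.

Definition compress := compress_pair @: T.

Let symT i j : ((i, j) \in T) = ((j, i) \in T).
Proof. by apply/idP/idP; apply: sT. Qed.

Let pDq : p != q. Proof. by rewrite -val_eqE /= ltn_eqF. Qed.

Lemma compress_mem i j x : (i, j) \in T -> compress_pair (i, j) = x -> x \in compress.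
Proof. by move=> ijT <-; apply: imset_f. Qed.

Lemma compress_sym i j : (i, j) \in compress -> (j, i) \in compress.
Proof.
move=> /imsetP[[k l] klT ij]; apply: compress_mem (sT klT) _.
have -> : (j, i) = ((compress_pair (k, l)).2, (compress_pair (k, l)).1) by rewrite -ij.
rewrite /compress_pair /=.
have kl : ~~ ((k == q) && (l == q)).
  by apply/negP => /andP[/eqP kq /eqP lq]; move: klT; rewrite kq lq (negPf (iT q)).
rewrite [(l, p) \in T]symT [(k, p) \in T]symT; move: kl.
by case: (k =P q) => _; case: (l =P q) => _ //= _; case: ifP.
Qed.

Lemma compress_irr i : (i, i) \notin compress.
Proof.
apply/negP => /imsetP[[k l] klT]; rewrite /compress_pair /=.
case: ifP => [/and3P[_ lp _] [-> pl]|_]; first by rewrite pl eqxx in lp.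
case: ifP => [/and3P[_ kp _] [-> kpE]|_ [ik il]]; first by rewrite kpE eqxx in kp.
by move: klT; rewrite -ik -il (negPf (iT i)).
Qed.

(** Under [transv p q 1], [Xp p l] becomes [Xp p l + Xp q l], with leading term [Xp q l] because
    [p < q]. If only [(p, l)] is missing from [T], this makes [(q, l)] missing, as the compression
    does; if both are missing, the difference of the two coordinates is mapped to [Xp p l]. *)
Lemma compress_lead i j : (i, j) \notin compress ->
  exists2 v, section_ideal T (transv p q (- 1) v) & lower wt 1 (2 ^ i + 2 ^ j) (Xp i j - v).
Proof.
have qDp : q != p by rewrite eq_sym.
have idT := idl_ideal (section_gens (F := F) T); have subT := ideal_subspace idT.
suff main : (i, j) \notin compress ->
    exists2 x, section_ideal T x & lower wt 1 (2 ^ i + 2 ^ j) (Xp i j - transv p q 1 x).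
  move=> /main[x Tx lx]; exists (transv p q 1 x) => //.
  by have := transvK pDq (- 1) x; rewrite opprK => ->.
have l0 w : lower wt 1 w (0 : S) by case: (lower_subspace F wt 1 w).
have pw (k : 'I_m) : (2 ^ p + 2 ^ k < 2 ^ q + 2 ^ k)%N by rewrite ltn_add2r ltn_exp2l.
have tX k l : k != p -> l != p -> transv p q 1 (Xp k l) = Xp k l.
  move=> kp lp; rewrite transvXp /transv_Xp /transv_coef (negPf kp) (negPf lp).
  by rewrite !mul0r !addr0.
have tXp l : l != p -> transv p q 1 (Xp p l) = Xp p l + Xp q l.
  move=> lp; rewrite transvXp /transv_Xp /transv_coef (negPf lp) eqxx.
  by rewrite mul1r mul0r addr0.
have main1 k l : l != p -> (k, l) \notin compress ->
    exists2 x, section_ideal T x & lower wt 1 (2 ^ k + 2 ^ l) (Xp k l - transv p q 1 x).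
  move=> lp klT'; have [kp|kp] := eqVneq k p.
    rewrite {k}kp in klT' *; have plT : (p, l) \notin T.
      apply: contra klT' => plT; apply: compress_mem plT _.
      by rewrite /compress_pair /= (negPf pDq) eqxx andbF.
    have [lq|lq] := eqVneq l q.
      exists (Xp p l); first exact: section_ideal_Xp.
      by rewrite tXp // lq Xp_diag addr0 subrr.
    have qlT : (q, l) \notin T.
      apply: contra klT' => qlT; apply: compress_mem qlT _.
      by rewrite /compress_pair /= eqxx lp plT.
    exists (Xp p l - Xp q l).
      by apply: subspaceB => //; apply: section_ideal_Xp.
    by rewrite raddfB /= tXp // tX // addrK subrr.
  have [klT|klT] := boolP ((k, l) \in T); last first.
    by exists (Xp k l); [apply: section_ideal_Xp|rewrite tX // subrr].
  have : ~~ (compress_pair (k, l) == (k, l)).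
    by apply: contra klT' => /eqP; apply: compress_mem.
  rewrite /compress_pair /=; case: ifP => [/and3P[/eqP-> _ plT] _|_].
    exists (Xp p l); first exact: section_ideal_Xp.
    rewrite tXp // opprD addrCA subrr addr0.
    by apply: subspaceN; [apply: lower_subspace|apply: Xp_lower; apply: pw].
  case: ifP => [/and3P[/eqP-> _ kpT] _|]; last by rewrite eqxx.
  exists (Xp k p); first exact: section_ideal_Xp.
  rewrite (Xp_anti F p k) raddfN /= tXp // (Xp_anti F q k) opprK addrCA addNr addr0.
  by apply: Xp_lower; rewrite [X in (_ < X)%N]addnC; apply: pw.
(* Antisymmetry reduces a pair with second index [p] to the previous case. *)
move=> ijT'; have [jp|jp] := eqVneq j p; last exact: main1.
rewrite {j}jp in ijT' *; have [ip|ip] := eqVneq i p.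
  by rewrite ip Xp_diag; exists 0; [case: idT|rewrite raddf0 subrr].
have [|x Tx lx] := main1 p i ip; first by apply: contra ijT' => /compress_sym.
exists (- x); first exact: subspaceN.
rewrite raddfN /= Xp_anti -opprD addnC; apply: subspaceN lx.
exact: lower_subspace.
Qed.

Lemma hilbert_le_compress d N : hilbert_le (section_ideal compress) d N ->
  exists2 M, (M <= N)%N & hilbert_le (section_ideal T) d M.
Proof.
move=> /(hilbert_le_plucker_degenerate (transv_ideal p q T)).
case=> [i j k l|i j|M MN HM]; first exact: transv_rel.
  exact: compress_lead.
by exists M => //; apply: hilbert_le_transv HM.
Qed.

Lemma sum_compress j : (q, j) \in T -> p != j -> (p, j) \notin T ->
  (\sum_(x in compress) (x.1 + x.2) < \sum_(x in T) (x.1 + x.2))%N.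
Proof.
move=> qjT pj pjT; apply: leq_ltn_trans (sum_imset_le _ _ _) _.
have le x : ((compress_pair x).1 + (compress_pair x).2 <= x.1 + x.2)%N.
  rewrite /compress_pair; case: ifP => [/andP[/eqP-> _]|_].
    by rewrite leq_add2r ltnW.
  by case: ifP => [/andP[/eqP-> _]|_ //]; rewrite leq_add2l ltnW.
rewrite (bigD1 (q, j)) //= [X in (_ < X)%N](bigD1 (q, j)) //= -addSn.
apply: leq_add; last exact: leq_sum.
by rewrite /compress_pair /= eqxx eq_sym pj pjT /= ltn_add2r.
Qed.

End Compression.

(** Each compression at a violation of shiftedness lowers the sum of all indices in the set, so the
    process ends. *)
Lemma shifted_degeneration T : (forall i j, (i, j) \in T -> (j, i) \in T) ->
  (forall i, (i, i) \notin T) ->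
  exists T', [/\ shifted T', (#|T'| <= #|T|)%N &
    forall d N, hilbert_le (section_ideal T') d N ->
      exists2 M, (M <= N)%N & hilbert_le (section_ideal T) d M].
Proof.
have [n] := ubnP (\sum_(x in T) (x.1 + x.2))%N; elim: n => // n IH in T * => Tn sT iT.
have [shT|/existsNP[p /existsNP[q /existsNP[j /not_implyP[qjT]]]]] :=
    EM (forall p q j, (q, j) \in T -> (p < q)%N -> p != j -> (p, j) \in T).
  by exists T; split=> // d N HN; exists N.
move=> /not_implyP[pq /not_implyP[pj /negP pjT]].
have [|||T' [shT' cT' HT']] := IH (compress T p q).
- exact: leq_trans (sum_compress pq qjT pj pjT) Tn.
- exact: compress_sym.
- exact: compress_irr.
exists T'; split=> //; first exact: leq_trans cT' (leq_imset_card _ _).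
move=> d N /HT'[M MN /(hilbert_le_compress pq sT iT)[M' M'M HM']].
by exists M' => //; apply: leq_trans MN.
Qed.

End Shifting.

(** * Degeneration of an arbitrary linear section *)

Section Pivots.
Variables (F : fieldType) (m : nat).
Local Notation S := {mpoly F[nplucker m]}.
Implicit Types (f g h : S) (i j k l : 'I_m) (T : {set 'I_m * 'I_m}).
Local Notation wt := (plucker_weight (m := m)).

Lemma annihilator_relation (U : {vspace 'rV[F]_(nplucker m)}) (P : {set 'I_(nplucker m)}) :
  (\dim U < #|P|)%N -> exists c : 'I_(nplucker m) -> F,
    [/\ forall e, e \notin P -> c e = 0, exists e, c e != 0 &
        forall u : 'rV_(nplucker m), u \in U -> \sum_e c e * u 0 e = 0].
Proof.
move=> ltUP; pose A := \matrix_(s < #|P|, r < \dim U) (vbasis U)`_r 0 (enum_val s).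
have kA0 : kermx A != 0.
  rewrite -mxrank_eq0 mxrank_ker subn_eq0 -ltnNge.
  exact: leq_ltn_trans (rank_leq_col _) ltUP.
have [s /rV0Pn[s0 cs0]] : exists s, row s (kermx A) != 0.
  apply/existsP; apply: contraNT kA0 => /existsPn u0; apply/eqP/row_matrixP => i.
  by have /negbNE/eqP -> := u0 i; rewrite row0.
have cA : row s (kermx A) *m A = 0 by rewrite -row_mul mulmx_ker row0.
move: (row s _) cs0 cA => v vs0 vA.
pose c e := \sum_(s < #|P| | enum_val s == e) v 0 s.
have cval s' : c (enum_val s') = v 0 s'.
  rewrite /c (bigD1 s') //= big1 ?addr0 // => s'' /andP[/eqP/enum_val_inj ->].
  by rewrite eqxx.
exists c; split=> [e eP||u uU].
- rewrite /c big1 // => s' /eqP ee; by rewrite -ee enum_valP in eP.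
- by exists (enum_val s0); rewrite cval.
- have cb r : \sum_e c e * (vbasis U)`_r 0 e = 0.
    have [rU|rU] := ltnP r (\dim U); last first.
      by rewrite big1 // => e _; rewrite nth_default ?size_tuple // mxE mulr0.
    have /rowP/(_ (Ordinal rU)) := vA; rewrite !mxE => vA0; rewrite -[RHS]vA0.
    rewrite (bigID (mem P)) /= [X in _ + X]big1 ?addr0 => [|e eP]; last first.
      rewrite /c big1 ?mul0r // => s' /eqP ee; by rewrite -ee enum_valP in eP.
    rewrite big_enum_val /=; apply: eq_bigr => s' _.
    by rewrite cval mxE.
  rewrite (coord_vbasis uU).
  under eq_bigr do rewrite summxE mulr_sumr.
  rewrite exchange_big big1 //= => r _.
  under eq_bigr do rewrite mxE mulrCA.
  by rewrite -mulr_sumr cb mulr0.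
Qed.

(** [T] collects the pairs whose coordinate is not a leading term of [I]. More than [\dim U] such
    coordinates would support a nonzero linear form vanishing on [U], whose heaviest coordinate is a
    leading term. The factor 2 counts both orderings. *)
Lemma linear_section_pivots (U : {vspace 'rV[F]_(nplucker m)}) (I : S -> Prop) :
  ideal I ->
  (forall f, f \is 1.-homog ->
     (forall u : 'rV_(nplucker m), u \in U -> f.@[u 0] = 0) -> I f) ->
  exists T, [/\ forall i j, (i, j) \in T -> (j, i) \in T, forall i, (i, i) \notin T,
    (#|T| <= 2 * \dim U)%N &
    forall i j, (i, j) \notin T ->
      exists2 v, I v & lower wt 1 (2 ^ i + 2 ^ j) (Xp F i j - v)].
Proof.
move=> iI IU; have sI := ideal_subspace iI.
pose lead i j := exists2 v, I v & lower wt 1 (2 ^ i + 2 ^ j) (Xp F i j - v).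
have lead_sym i j : lead i j -> lead j i.
  move=> [v Iv lv]; exists (- v); first exact: subspaceN.
  by rewrite Xp_anti -opprD addnC; apply: subspaceN => //; apply: lower_subspace.
have lead_diag i : lead i i.
  exists 0; first by case: iI.
  by rewrite Xp_diag subr0; case: (lower_subspace F wt 1 (2 ^ i + 2 ^ i)).
pose T := [set x : 'I_m * 'I_m | ~~ `[< lead x.1 x.2 >]]%SET.
have TP i j : reflect (~ lead i j) ((i, j) \in T).
  by rewrite inE /=; apply: (iffP negP) => lij; [move/asboolP|move/asboolP].
exists T; split=> [i j /TP nl|i|| i j ijT].
- by apply/TP => /lead_sym.
- by apply/TP => /(_ (lead_diag i)).
- pose P := [set e : 'I_(nplucker m) | plucker_pair e \in T]%SET.
  have TsubP : T \subset (@plucker_pair m @: P) :|: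
      ((fun e => ((plucker_pair e).2, (plucker_pair e).1)) @: P).
    apply/fintype.subsetP => -[i j] ijT; rewrite finset.in_setU.
    case: (ltngtP i j) => [ij|ji|/val_inj ij].
    + apply/orP; left; have [e ee] := plucker_pair_surj ij.
      by apply/imsetP; exists e; [rewrite [e \in P]inE ee|].
    + apply/orP; right; have [e ee] := plucker_pair_surj ji.
      apply/imsetP; exists e; rewrite ?ee // [e \in P]inE ee.
      by apply/TP => /lead_sym; apply/TP.
    + by move/TP: ijT; rewrite ij => /(_ (lead_diag j)).
  apply: (leq_trans (subset_leq_card TsubP)); apply: (leq_trans (leq_card_setU _ _)).
  rewrite mul2n -addnn.
  suff cP : (#|P| <= \dim U)%N by apply: leq_add; apply: leq_trans (leq_imset_card _ _) cP.
  rewrite leqNgt; apply/negP => /annihilator_relation[c [cP [e1 ce1] cU]].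
  case: (@arg_maxnP _ e1 (fun e => c e != 0) (fun e => wt U_(e)%MM) ce1) => e0 /= ce0 e0max.
  pose g : S := \sum_e c e *: 'X_e.
  have Ig : I g.
    apply: IU => [|u uU].
      by apply: rpred_sum => e _; apply: dhomogZ; rewrite dhomogX; apply/eqP/mdeg1.
    rewrite raddf_sum /= -[RHS](cU u uU); apply: eq_bigr => e _.
    by rewrite mevalZ mevalXU.
  have e0P : e0 \in P by apply: contraNT ce0 => /cP ->.
  have : plucker_pair e0 \in T by rewrite [e0 \in P]inE in e0P.
  case e0ij : (plucker_pair e0) => [i j] /TP; apply.
  exists ((c e0)^-1 *: g); first exact: subspaceZ.
  have -> : Xp F i j = 'X_e0 by rewrite -Xp_pair e0ij.
  rewrite /g (bigD1 e0) //= scalerDr scalerA mulVf // scale1r opprD addrA subrr add0r.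
  apply: subspaceN; first exact: lower_subspace.
  apply: subspaceZ; first exact: lower_subspace.
  apply: subspace_sum => [|e _ ee0]; first exact: lower_subspace.
  have [->|ce] := eqVneq (c e) 0.
    by rewrite scale0r; case: (lower_subspace F wt 1 (2 ^ i + 2 ^ j)).
  apply: subspaceZ; first exact: lower_subspace.
  split=> [|x]; first by rewrite dhomogX; apply/eqP/mdeg1.
  rewrite msuppX inE => /eqP ->.
  have := plucker_weight1 e0; rewrite e0ij /= => <-.
  rewrite ltn_neqAle e0max // andbT; apply: contra ee0 => /eqP.
  by move/plucker_weight1_inj ->.
- by apply: contrapT => nl; move/TP: ijT; apply.
Qed.

End Pivots.

(** * Comparison of growth rates *)

Lemma ffact_expn_le d l : (d.+1 ^ l <= (d + l) ^_ l)%N.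
Proof.
elim: l => // l IH; rewrite addnS ffactSS expnS leq_mul //.
by rewrite ltnS leq_addr.
Qed.

Lemma binomial_growth c t l : exists d, (c * (t * d).+1 ^ l < 'C(d + l.+1, l.+1))%N.
Proof.
(* As [(l + 1)! 'C(d + l + 1, l + 1)] is at least [(d + 1) ^ (l + 1)] and [(t d + 1) ^ l] is at most
   [(t + 1) ^ l (d + 1) ^ l], it suffices that [d + 1] exceeds [(l + 1)! c (t + 1) ^ l]. *)
pose d := (l.+1`! * (c * t.+1 ^ l))%N; exists d.
rewrite -(ltn_pmul2r (fact_gt0 l.+1)) bin_ffact.
apply: leq_trans (ffact_expn_le d l.+1); rewrite expnS.
have : ((t * d).+1 ^ l <= (t.+1 * d.+1) ^ l)%N by apply: leq_exp_base; lia.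
have : (0 < d.+1 ^ l)%N by rewrite expn_gt0.
rewrite expnMn; have : d = (l.+1`! * (c * t.+1 ^ l))%N by [].
move: (t.+1 ^ l)%N (d.+1 ^ l)%N (l.+1`!)%N ((t * d).+1 ^ l)%N => A B f X -> B0 XAB.
apply: leq_ltn_trans (_ : (f * (c * A) * B < _)%N); last first.
  by rewrite mulSn -[X in (X < _)%N]add0n ltn_add2r.
have -> : (f * (c * A) * B = c * (A * B) * f)%N by ring.
by rewrite leq_mul2r leq_mul2l XAB !orbT.
Qed.

Section ChainBound.
Variables (F : fieldType) (m : nat).
Local Notation S := {mpoly F[nplucker m]}.

(** The chain forces growth with exponent [l]. If all pairs of the shifted set [T] had index sum at
    most [l], the exponent would be at most [l - 1]; so some pair has a larger sum, and [T] contains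
    all pairs below it. *)
Lemma prime_chain_bound (U : {vspace 'rV[F]_(nplucker m)}) (q : nat -> S -> Prop) l :
  (forall i, (i <= l)%N -> homogeneous_prime (q i)) -> (exists i, ~ q 0 'X_i) ->
  (forall i, (i < l)%N ->
     (forall f, q i.+1 f -> q i f) /\ exists f, q i f /\ ~ q i.+1 f) ->
  (forall i j k h, q l (plucker_rel F i j k h)) ->
  (forall f, f \is 1.-homog ->
     (forall u : 'rV_(nplucker m), u \in U -> f.@[u 0] = 0) -> q l f) ->
  exists i j : 'I_m, [/\ (i < j)%N, (l < i + j)%N & (#|schubert_set i j| <= 2 * \dim U)%N].
Proof.
move=> qp q0 qS qrel qU; have [t t0 geq] := hilbert_ge_chain qp q0 qS.
have [iq _ _ _] := qp _ (leqnn l); have sq := ideal_subspace iq.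
have [T0 [sT0 iT0 cT0 lT0]] := linear_section_pivots iq qU.
have [T [shT cT HT]] := shifted_degeneration F sT0 iT0.
have bound d N : hilbert_le (section_ideal (F := F) T) (t * d) N -> ('C(d + l, l) <= N)%N.
  move=> /HT[M MN /(hilbert_le_plucker_degenerate iq qrel lT0)[M' M'M HM']].
  by apply: leq_trans MN; apply: leq_trans M'M; apply: hilbert_ge_le (geq d) HM'.
(* An empty set would leave nothing in the positive degree [t]. *)
have [T_0|T_n0] := eqVneq T finset.set0.
  have := @bound 1%N 0%N; rewrite muln1 T_0 -(prednK t0) leqn0 => /(_ (hilbert_le_empty _ _ _)).
  by rewrite -leqn0 leqNgt bin_gt0 leq_addl.
apply: contrapT => nij.
have le_l i j : (i, j) \in T -> (i + j <= l)%N.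
  have [sT iT _] := shT.
  have main (k h : 'I_m) : (k < h)%N -> (k, h) \in T -> (k + h <= l)%N.
    move=> kh khT; rewrite leqNgt; apply/negP => lkh; apply: nij; exists k, h; split=> //.
    apply: leq_trans cT0; apply: leq_trans cT; apply: subset_leq_card.
    exact: schubert_set_sub.
  move=> ijT; case: (ltngtP i j) => [/main|/main|/val_inj ij]; first exact.
    by rewrite addnC; apply; apply: sT.
  by move: ijT; rewrite ij (negPf (iT _)).
(* For [l = 0] there is no exponent [l - 1], but a pair of distinct indices has positive sum. *)
case: l le_l bound {qp qS qrel qU geq iq sq lT0 nij} => [|l] le_l bound.
  have [i [j [ij ijT _ _]]] := shifted_top shT T_n0.
  by have := le_l _ _ ijT; rewrite leqn0 addn_eq0 => /andP[_ /eqP j0]; rewrite j0 in ij.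
have [c Hc] := hilbert_le_shifted F shT le_l.
have [d] := binomial_growth c t l; rewrite ltnNge => /negP; apply.
by have [N NP /bound bN] := Hc (t * d)%N; apply: leq_trans NP.
Qed.

End ChainBound.

(** * Irreducible closed sets and prime ideals *)

Local Open Scope classical_set_scope.
Local Open Scope ring_scope.

Section ProjPoints.
Variables (F : fieldType) (n : nat).
Local Notation S := {mpoly F[n]}.
Implicit Types (p : set S) (Z : set (set S)).

Lemma mem_set_pred p f : reflect (p f) (f \in [pred g | g \in p]).
Proof. by rewrite inE; apply: (iffP idP) => [/set_mem|/mem_set]. Qed.

Lemma ProjP p : Proj p <-> homogeneous_prime p /\ exists i, ~ p 'X_i.
Proof.
split=> [[[[p0 p1 pM] hp] pprime pX]|[[[p0 pM] hp p1 pprime] pX]].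
  split=> //; split=> //.
  - split=> [|h u v pu pv]; first exact/mem_set_pred.
    by apply/mem_set_pred/pM; apply/mem_set_pred.
  - by move=> /mem_set_pred; apply/negP.
  - move=> f g /mem_set_pred/pprime/orP[] /mem_set_pred; first by left.
    by right.
split=> //.
- split=> //; split; first exact/mem_set_pred.
    by apply/mem_set_pred.
  by move=> h u v /mem_set_pred pu /mem_set_pred pv; apply/mem_set_pred/pM.
- by move=> f g /mem_set_pred/pprime[] /mem_set_pred ->; rewrite ?orbT.
Qed.

Definition vanishing_ideal Z : set S := fun f => forall p, Z p -> p f.

(** If [f * g] vanishes on [Z], then [Z] lies in the union of the zero loci of [f] and [g], hence in
    one of them. *)
Lemma irreducible_vanishing_ideal Z : irreducible_closed Z ->
  Proj (vanishing_ideal Z) /\ Z = zero_locus (vanishing_ideal Z).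
Proof.
move=> [[A ZA] [p0 Zp0] Zirr].
have Zproj p : Z p -> homogeneous_prime p /\ exists i, ~ p 'X_i.
  by rewrite ZA => -[/ProjP].
split; last first.
  apply/seteqP; split=> [p Zp|p [pP Zp]].
    by split; [move: Zp; rewrite ZA => -[]|move=> f; apply].
  by rewrite ZA; split=> // f Af; apply: Zp => p'; rewrite ZA => -[_]; apply.
have [[[_ _] _ p01 _] [i p0i]] := Zproj _ Zp0.
apply/ProjP; split; last by exists i => /(_ _ Zp0).
split=> [|f d Zf p Zp||f g Zfg].
- split=> [p Zp|h u v Zu Zv p Zp]; first by have [[[]]] := Zproj _ Zp.
  by have [[[_ pM] _ _ _] _] := Zproj _ Zp; apply: pM; [apply: Zu|apply: Zv].
- by have [[_ hp _ _] _] := Zproj _ Zp; apply: hp; apply: Zf.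
- by move=> /(_ _ Zp0).
- have Zcl (h : S) : Zariski_closed (zero_locus [set h]) by exists [set h].
  have [p Zp|Zf|Zg] := Zirr _ _ (Zcl f) (Zcl g).
  + have Pp : Proj p by move: Zp; rewrite ZA => -[].
    have [[_ _ _ pM] _] := Zproj _ Zp.
    by have [pf|pg] := pM _ _ (Zfg _ Zp); [left|right]; split=> // _ ->.
  + by left=> p /Zf[_]; apply.
  + by right=> p /Zg[_]; apply.
Qed.

(** The point [p] is generic: a closed set containing it contains [zero_locus p]. *)
Lemma zero_locus_irreducible p : Proj p -> irreducible_closed (zero_locus p).
Proof.
move=> pP; have pp : zero_locus p p by split.
split; [by exists p|by exists p|move=> _ _ [A ->] [B ->] /(_ _ pp)].
by case=> -[_ Ap]; [left|right] => q [qP pq]; split=> // f /Ap /pq.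
Qed.

End ProjPoints.

Section SectionChain.
Variables (F : fieldType) (m : nat).
Local Notation S := {mpoly F[nplucker m]}.

Lemma meval_Xp (L : fieldType) (iota : {rmorphism F -> L}) (W : 'M[L]_(2, m)) i j :
  (map_mpoly iota (Xp F i j)).@[plucker W] = W 0 i * W 1 j - W 0 j * W 1 i.
Proof.
have lt (k l : 'I_m) : (k < l)%N ->
    (map_mpoly iota (Xp F k l)).@[plucker W] = W 0 k * W 1 l - W 0 l * W 1 k.
  move=> /plucker_pair_surj[e ekl]; have := Xp_pair F e; rewrite ekl /= => ->.
  by rewrite map_mpolyX mevalXU /plucker -/(plucker_pair e) ekl.
case: (ltngtP i j) => [/lt //|ji|/val_inj ->].
  by rewrite Xp_anti !raddfN /= (lt _ _ ji) opprB.
by rewrite Xp_diag !raddf0 subrr.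
Qed.

Lemma plucker_rel_grassmannian i j k l : @grassmannian_ideal F m (plucker_rel F i j k l).
Proof.
move=> L iota W _; rewrite /plucker_rel !(raddfD, raddfN) /= !rmorphM /= !meval_Xp.
ring.
Qed.

(** Vanishing ideals reverse inclusions, so [q 0] is the largest prime, as [hilbert_ge_chain]
    expects. *)
Lemma section_chain_bound (U : {vspace 'rV[F]_(nplucker m)}) l c :
  irreducible_chain (linear_section U) l c ->
  exists i j : 'I_m, [/\ (i < j)%N, (l < i + j)%N & (#|schubert_set i j| <= 2 * \dim U)%N].
Proof.
move=> [cirr clt]; pose q i := vanishing_ideal (c i).
have qP i : (i <= l)%N -> Proj (q i) /\ c i = zero_locus (q i).
  by move=> /cirr[/irreducible_vanishing_ideal].
apply: (@prime_chain_bound _ _ _ q).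
- by move=> i /qP[/ProjP[]].
- by have [/ProjP[]] := qP 0%N isT.
- move=> i il; have [lti nlt] := clt i il; split=> [f qf p cp|].
    by apply: qf; apply: lti.
  apply: contrapT => nex; apply: nlt.
  have [_ ->] := qP _ (ltnW il); have [_ ->] := qP _ il.
  move=> p [pP qp]; split=> // f qf; apply: qp; apply: contrapT => nqf.
  by apply: nex; exists f.
- move=> i j k h p cp; have [_ csub] := cirr _ (leqnn l).
  by have [[_ Gp] _] := csub _ cp; apply/Gp/plucker_rel_grassmannian.
- move=> f f1 fU p cp; have [_ csub] := cirr _ (leqnn l).
  by have [_ [_ Lp]] := csub _ cp; apply: Lp.
Qed.

End SectionChain.

(** * Counting Pluecker coordinates *)

Section Cardinality.
Variable m : nat.
Implicit Types i j k l : 'I_m.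

Definition plucker_below i j : {set 'I_(nplucker m)} :=
  [set e | ((plucker_pair e).1 <= i)%N && ((plucker_pair e).2 <= j)%N]%SET.

Lemma card_ord_interval n a b : (b < n)%N -> (\sum_(l < n | a < l <= b) 1 = b - a)%N.
Proof.
move=> bn; rewrite big_mkcond /=.
have -> N : (\sum_(x < N) (if a < x <= b then 1 else 0) = minn N b.+1 - a.+1)%N.
  elim: N => [|N IH]; first by rewrite big_ord0 min0n.
  by rewrite big_ord_recr /= IH; case: ifP; lia.
lia.
Qed.

Lemma sum_sub_iota a b : (a < b)%N ->
  (2 * (\sum_(k < a.+1) (b - k)) + a.+1 * a.+2 = 2 * (a.+1 * b.+1))%N.
Proof.
elim: a => [|a IH] ab; first by rewrite big_ord1 /= subn0; lia.
rewrite big_ord_recr /=; have := IH (ltnW ab); move: (\sum_(_ < _) _)%N => s.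
have -> : b = (a.+1 + (b - a.+1))%N by lia.
by move: (b - a.+1)%N => t; rewrite addKn; lia.
Qed.

(** Each first index [k <= i] admits [j - k] second indices. *)
Lemma card_plucker_below i j : (i < j)%N ->
  (2 * #|plucker_below i j| + i.+1 * i.+2 = 2 * (i.+1 * j.+1))%N.
Proof.
move=> ij; rewrite -(sum_sub_iota ij); congr (2 * _ + _)%N.
rewrite -(card_imset _ (@plucker_pair_inj m)).
rewrite (_ : _ @: _ = [set x : 'I_m * 'I_m | (x.1 < i.+1)%N && (x.1 < x.2 <= j)%N]%SET).
  rewrite -sum1_card (eq_bigl (fun x : 'I_m * 'I_m => (x.1 < i.+1)%N && (x.1 < x.2 <= j)%N)).
    rewrite -(pair_big_dep (fun k : 'I_m => (k < i.+1)%N) (fun k l : 'I_m => (k < l <= j)%N)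
      (fun _ _ => 1%N)) /=.
    under eq_bigr do rewrite card_ord_interval //.
    by rewrite -(big_ord_widen _ (fun x => (j - x)%N) (ltn_ord i)).
  by move=> x; rewrite inE.
apply/finset.setP => -[k l]; rewrite inE /= ltnS; apply/imsetP/idP => [[e]|/and3P[ki kl lj]].
  by rewrite inE => + kle; have := plucker_pair_lt e; rewrite -kle /= => -> /andP[-> ->].
have [e ee] := plucker_pair_surj kl.
by exists e; rewrite ?ee // inE ee /= ki.
Qed.

Lemma plucker_below_sub i j k l : (k <= i)%N -> (l <= j)%N ->
  plucker_below k l \subset plucker_below i j.
Proof.
move=> ki lj; apply/fintype.subsetP => e; rewrite !inE => /andP[ek el].
by rewrite (leq_trans ek ki) (leq_trans el lj).
Qed.

Lemma card_schubert_set i j : (2 * #|plucker_below i j| <= #|schubert_set i j|)%N.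
Proof.
pose P := @plucker_pair m @: plucker_below i j.
pose swap (x : 'I_m * 'I_m) := (x.2, x.1).
have swap_inj : injective swap by move=> [a b] [c d] [-> ->].
have PP x : x \in P -> [&& x.1 < x.2, x.1 <= i & x.2 <= j]%N.
  by move=> /imsetP[e]; rewrite inE => eij ->; rewrite plucker_pair_lt.
have dis : P :&: swap @: P = finset.set0.
  apply/finset.setP => x; rewrite !inE; apply/negP => /andP[/PP/andP[lt1 _]].
  by move=> /imsetP[y /PP/andP[lt2 _] xy]; move: lt1; rewrite xy /= ltnNge ltnW.
rewrite mul2n -addnn -(card_imset _ (@plucker_pair_inj m)) -/P -{2}(card_imset _ swap_inj).
rewrite -cardsUI dis cards0 addn0; apply: subset_leq_card.
apply/fintype.subsetP => x; rewrite finset.in_setU => /orP[/PP/and3P[lt xi xj]|].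
  by rewrite inE -val_eqE /= ltn_eqF // xi xj.
move=> /imsetP[y /PP/and3P[lt xi xj] ->].
by rewrite inE -val_eqE /= gtn_eqF // xi xj orbT.
Qed.

End Cardinality.

(* [(2 l + 5 - 3 a) a / 2] is the number of Pluecker coordinates of the
   [l]-dimensional Schubert variety [(a, l + 3 - a)]. *)
Lemma c1E m d : c1 m d =
  (d%:R + 3 - m%:R) * (2 * d%:R + 5 - 3 * (d%:R + 3 - m%:R)) / 2.
Proof. by rewrite /c1; field. Qed.

Lemma c2_even s : c2 (2 * s) = (s%:R + 1) * (s%:R + 2) / 2.
Proof. by rewrite /c2 oddM /= natrM; field. Qed.

Lemma c2_odd s : c2 (2 * s).+1 = (s%:R + 1) * (s%:R + 4) / 2.
Proof. by rewrite /c2 /= oddM /= -natr1 natrM; field. Qed.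

Lemma natr_below (N i j : nat) : (2 * N + i.+1 * i.+2 = 2 * (i.+1 * j.+1))%N ->
  N%:R = (i%:R + 1) * (2 * j%:R - i%:R) / 2 :> rat.
Proof.
move=> /(congr1 (fun n => n%:R : rat)); rewrite natrD !natrM -!natr1 => Neq.
have -> : N%:R = (2 * N%:R + (i%:R + 1) * (i%:R + 1 + 1) -
  (i%:R + 1) * (i%:R + 1 + 1)) / 2 :> rat by field.
by rewrite Neq; field.
Qed.

Lemma even_or_odd n : exists s, n = (2 * s)%N \/ n = (2 * s).+1.
Proof.
exists n./2; have := odd_double_half n; rewrite -mul2n.
by case: (odd n) => /= nE; [right|left]; rewrite -[LHS]nE.
Qed.

(** For fixed [i + j = l + 1] the count is a concave quadratic in [i], so it is least at an end of
    the range: [j = m - 1] gives [c1], the most balanced pair gives [c2], and for small [l] the end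
    [i = 0] gives [l + 1]. *)
Lemma C_le_below m l N i j : (i < j < m)%N -> (i + j = l.+1)%N ->
  (2 * N + i.+1 * i.+2 = 2 * (i.+1 * j.+1))%N -> C m l <= N%:R.
Proof.
move=> /andP[ij jm] ijl NE; rewrite /C; case: leqP => lm.
  (* With [j = i + 1 + t], [2 N - 2 (l + 1)] equals [i ^ 2 - i + 2 i t]. *)
  have ii : (i <= i * i)%N by case: (i) => // n; rewrite leq_pmulr.
  rewrite natr1 ler_nat -ijl; move: NE; rewrite -(subnKC ij).
  have := leq0n (i * (j - i.+1)); move: (j - i.+1)%N => t it.
  by clear -ii it; lia.
rewrite ge_min c1E (natr_below NE).
have -> : j%:R = l%:R + 1 - i%:R :> rat by rewrite natr1 -ijl natrD addrC addKr.
have mj : l%:R + 2 - m%:R <= i%:R :> rat.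
  by rewrite lerBlDr -!natrD ler_nat; lia.
(* The slope of the chord from [l + 2 - m] to [i] decides. If it is nonnegative, the count is at
   least [c1]; otherwise, by concavity, the count decreases from [i] to the last index [s], where it
   is [c2]. *)
have [le1|gt1] := lerP (3 * (i%:R + l%:R + 4 - m%:R)) (2 * l%:R + 5 : rat).
  apply/orP; left; rewrite -subr_ge0.
  rewrite [X in 0 <= X](_ : _ = (i%:R - (l%:R + 2 - m%:R)) *
    (2 * l%:R + 5 - 3 * (i%:R + l%:R + 4 - m%:R)) / 2); last by field.
  by rewrite divr_ge0 // mulr_ge0 // subr_ge0.
apply/orP; right; rewrite -subr_ge0.
have [s ls] := even_or_odd l.
have is_ : i%:R <= s%:R :> rat by rewrite ler_nat; lia.
case: ls => ls; move: ij ijl lm mj gt1; rewrite ls ?c2_even ?c2_odd => ij ijl lm mj gt1.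
  rewrite natrM [X in 0 <= X](_ : _ = (s%:R - i%:R) *
    (3 * (i%:R + 1 + (s%:R + 1)) - (4 * s%:R + 5)) / 2); last by field.
  rewrite divr_ge0 // mulr_ge0 // ?subr_ge0 //.
  by move: gt1 mj; rewrite natrM; lra.
rewrite -(natr1 (2 * s)%N) natrM [X in 0 <= X](_ : _ = (s%:R - i%:R) *
    (3 * (i%:R + 1 + (s%:R + 1)) - (4 * s%:R + 7)) / 2); last by field.
rewrite divr_ge0 // mulr_ge0 // ?subr_ge0 //.
by move: gt1 mj; rewrite -(natr1 (2 * s)%N) natrM; lra.
Qed.

Lemma C_le_witness m d K : (3 <= m)%N -> (d <= 2 * (m - 2))%N -> C m d <= K%:R ->
  exists i j, [/\ (i < j < m)%N, (i + j = d.+1)%N &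
    forall N, (2 * N + i.+1 * i.+2 = 2 * (i.+1 * j.+1))%N -> (N <= K)%N].
Proof.
move=> m3 dm; rewrite /C; case: leqP => dm2.
  rewrite natr1 ler_nat => dK; exists 0%N, d.+1; split=> [||N]; lia.
have use i j (c : rat) : (i < j < m)%N -> (i + j = d.+1)%N -> c <= K%:R ->
    c = (i%:R + 1) * (2 * j%:R - i%:R) / 2 ->
    exists i j, [/\ (i < j < m)%N, (i + j = d.+1)%N &
      forall N, (2 * N + i.+1 * i.+2 = 2 * (i.+1 * j.+1))%N -> (N <= K)%N].
  move=> ijm ijd cK cE; exists i, j; split=> // N /natr_below NE.
  by rewrite -(ler_nat rat) NE -cE.
(* For [c1] the second index is the largest possible; for [c2] the pair is as balanced as the parity
   of [d] allows. *)
rewrite ge_min => /orP[cK|cK].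
  apply: (use (d.+2 - m)%N m.-1 _ _ _ cK); [lia|lia|].
  rewrite c1E natrB; last by lia.
  have -> : m%:R = m.-1%:R + 1 :> rat by rewrite natr1 prednK //; lia.
  by rewrite -!natr1; field.
have [s ds] := even_or_odd d.
case: ds => ds.
  apply: (use s s.+1 _ _ _ cK); [lia|lia|].
  by rewrite ds c2_even -natr1; field.
apply: (use s s.+2 _ _ _ cK); [lia|lia|].
by rewrite ds c2_odd -!natr1; field.
Qed.

(** * Schubert varieties *)

Section Schubert.
Variables (F : fieldType) (m : nat).
Local Notation S := {mpoly F[nplucker m]}.
Local Notation D := {mpoly F[m + m]}.
Implicit Types (a b : nat) (i j : 'I_m) (f g : S).

Definition schubert_row0 a i : D := if (i <= a)%N then 'X_(lshift m i) else 0.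
Definition schubert_row1 b j : D := if (j <= b)%N then 'X_(rshift m j) else 0.

Definition schubert_minor a b i j : D :=
  schubert_row0 a i * schubert_row1 b j - schubert_row0 a j * schubert_row1 b i.

(* Pluecker coordinates of the generic line meeting [<e_0, .., e_a>] and
   contained in [<e_0, .., e_b>]: the indices are one less than the usual ones,
   and the dimension of this Schubert variety is [a + b - 1]. *)
Definition schubert_eval a b : S -> D := comp_mpoly
  [tuple schubert_minor a b (plucker_pair e).1 (plucker_pair e).2 | e < nplucker m].

HB.instance Definition _ a b := GRing.LRMorphism.copy (schubert_eval a b) (comp_mpoly
  [tuple schubert_minor a b (plucker_pair e).1 (plucker_pair e).2 | e < nplucker m]).

Lemma schubert_evalX a b e :
  schubert_eval a b 'X_e = schubert_minor a b (plucker_pair e).1 (plucker_pair e).2.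
Proof. by rewrite /schubert_eval comp_mpolyXU -tnth_nth tnth_mktuple. Qed.

Lemma schubert_evalC a b c : schubert_eval a b c%:MP = c%:MP.
Proof. exact: comp_mpolyC. Qed.

Lemma schubert_row0_dhomog a i : schubert_row0 a i \is 1.-homog.
Proof.
rewrite /schubert_row0; case: ifP => _; last exact: dhomog0.
by rewrite dhomogX; apply/eqP/mdeg1.
Qed.

Lemma schubert_row1_dhomog b j : schubert_row1 b j \is 1.-homog.
Proof.
rewrite /schubert_row1; case: ifP => _; last exact: dhomog0.
by rewrite dhomogX; apply/eqP/mdeg1.
Qed.

Lemma schubert_eval_dhomog a b f d :
  f \is d.-homog -> schubert_eval a b f \is (2 * d).-homog.
Proof.
apply: comp_mpoly_dhomog => e; rewrite tnth_mktuple /schubert_minor -[2%N]addn1.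
by apply: dhomogD; [|rewrite dhomogN]; apply: dhomogM;
  [exact: schubert_row0_dhomog|exact: schubert_row1_dhomog|
   exact: schubert_row0_dhomog|exact: schubert_row1_dhomog].
Qed.

(** Taken as the kernel of the parametrisation instead of by equations, so that primality comes from
    the target being a domain. *)
Definition schubert_prime a b : set S := [set f | schubert_eval a b f = 0].

Lemma schubert_evalX0 a b e : (a < b)%N ->
  ~~ (((plucker_pair e).1 <= a) && ((plucker_pair e).2 <= b))%N ->
  schubert_prime a b 'X_e.
Proof.
move=> ab; have := plucker_pair_lt e; rewrite /schubert_prime /= schubert_evalX.
case: (plucker_pair e) => i j /= ij nij.
have aj : (a < j)%N by lia.
rewrite /schubert_minor /schubert_row0 /schubert_row1 [(j <= a)%N]leqNgt aj /= mul0r subr0.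
by move: nij; rewrite negb_and => /orP[]/negPf->; rewrite ?mul0r ?mulr0.
Qed.

Lemma schubert_minor_neq0 i j : (i < j)%N -> schubert_minor i j i j != 0.
Proof.
move=> ij; rewrite /schubert_minor /schubert_row0 /schubert_row1 !leqnn leqNgt ij /=.
rewrite mul0r subr0 mulf_neq0 // -msize_poly_eq0 ?msizeX ?mmeasureX //.
Qed.

Lemma schubert_evalX_neq0 e :
  ~ schubert_prime (plucker_pair e).1 (plucker_pair e).2 'X_e.
Proof.
rewrite /schubert_prime /= schubert_evalX; apply/eqP/schubert_minor_neq0.
exact: plucker_pair_lt.
Qed.

Lemma schubert_prime_Proj a b : (a < b < m)%N -> Proj (schubert_prime a b).
Proof.
move=> /andP[ab bm]; apply/ProjP; split; last first.
  have am := ltn_trans ab bm.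
  have [|e ee] := @plucker_pair_surj m (Ordinal am) (Ordinal bm); first by [].
  by exists e; have := @schubert_evalX_neq0 e; rewrite ee.
split; rewrite /schubert_prime /=.
- split=> [|h u v /= u0 v0]; first by rewrite /= raddf0.
  by rewrite raddfD /= rmorphM /= u0 v0 mulr0 addr0.
- move=> f d /= f0.
  have := congr1 (pihomog mdeg (2 * d)) f0.
  (* The maximum makes degree [d] occur among the summands even beyond the size of [f]. *)
  rewrite raddf0 {1}(@pihomog_partitionE _ _ mdeg (maxn (msize f) d.+1) f (leq_maxl _ _)).
  have dk : (d < maxn (msize f) d.+1)%N by rewrite leq_max ltnSn orbT.
  rewrite (raddf_sum (schubert_eval a b)) (raddf_sum (pihomog mdeg (2 * d))) /=.
  rewrite (bigD1 (Ordinal dk)) //= [X in _ + X]big1 ?addr0 => [|e ed].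
    by rewrite pihomog_dE //; apply/schubert_eval_dhomog/pihomogP.
  apply: (@pihomog_ne0 _ _ mdeg (2 * e)%N).
    by rewrite eqn_mul2l /= -val_eqE in ed *.
  by apply/schubert_eval_dhomog/pihomogP.
- by rewrite rmorph1; apply/eqP; rewrite oner_eq0.
- move=> f g /eqP; rewrite rmorphM mulf_eq0 => /orP[]/eqP; first by left.
  by right.
Qed.

(** Setting the variables beyond [a'] and [b'] to zero specialises the larger parametrisation to the
    smaller one. *)
Lemma schubert_prime_sub a b a' b' : (a' <= a)%N -> (b' <= b)%N ->
  schubert_prime a b `<=` schubert_prime a' b'.
Proof.
move=> aa bb f; rewrite /schubert_prime /= => f0.
pose sigma := comp_mpoly [tuple match split k with
  inl i => schubert_row0 a' i | inr j => schubert_row1 b' j end | k < m + m].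
have sX k : sigma 'X_k = match split k with
    inl i => schubert_row0 a' i | inr j => schubert_row1 b' j end.
  by rewrite /sigma comp_mpolyXU -tnth_nth tnth_mktuple.
have s0 i : sigma (schubert_row0 a i) = schubert_row0 a' i.
  rewrite /schubert_row0; case: ifP => [_|ia].
    by rewrite sX (unsplitK (inl i)).
  rewrite /sigma raddf0; case: ifP => // ia'.
  by rewrite (leq_trans ia' aa) in ia.
have s1 j : sigma (schubert_row1 b j) = schubert_row1 b' j.
  rewrite /schubert_row1; case: ifP => [_|jb].
    by rewrite sX (unsplitK (inr j)).
  rewrite /sigma raddf0; case: ifP => // jb'.
  by rewrite (leq_trans jb' bb) in jb.
have : (sigma \o schubert_eval a b) f = 0 by rewrite /= f0 /sigma raddf0.
rewrite (mpoly_rmorphism_ext (phi := sigma \o schubert_eval a b)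
  (psi := schubert_eval a' b')) // => [c|e] /=.
  by rewrite !schubert_evalC /sigma comp_mpolyC.
have sB x y : sigma (x - y) = sigma x - sigma y by rewrite /sigma raddfB.
have sM x y : sigma (x * y) = sigma x * sigma y by rewrite /sigma rmorphM.
change (sigma (schubert_eval a b 'X_e) = schubert_eval a' b' 'X_e).
by rewrite !schubert_evalX /schubert_minor sB !sM !s0 !s1.
Qed.

(** The generic matrix over the fraction field of the parameter ring is an admissible [W]: its
    columns [a] and [b] form a triangular block with nonzero diagonal. *)
Lemma grassmannian_schubert_prime a b : (a < b < m)%N ->
  @grassmannian_ideal F m `<=` schubert_prime a b.
Proof.
move=> /andP[ab bm] f Gf; have am := ltn_trans ab bm.
pose iota : {rmorphism F -> {fraction D}} := (@tofrac D \o @mpolyC (m + m) F).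
pose W : 'M[{fraction D}]_(2, m) :=
  \matrix_(r, i) tofrac (if r == 0 then schubert_row0 a i else schubert_row1 b i).
have rankW : \rank W = 2%N.
  have W0b : W 0 (Ordinal bm) = 0.
    by rewrite mxE /= /schubert_row0 /= leqNgt ab rmorph0.
  have Wneq0 (z : D) x : z = 'X_[x] -> tofrac z != 0.
    by move=> ->; rewrite tofrac_eq0 -msupp_eq0 msuppX.
  have W0a : W 0 (Ordinal am) != 0.
    by rewrite mxE /=; apply: Wneq0; rewrite /schubert_row0 /= leqnn.
  have W1b : W 1 (Ordinal bm) != 0.
    by rewrite mxE /=; apply: Wneq0; rewrite /schubert_row1 /= leqnn.
  apply/eqP; rewrite -[_ == _]/(row_free W) -kermx_eq0; apply/eqP/row_matrixP => r.
  rewrite row0; have : row r (kermx W) *m W = 0 by rewrite -row_mul mulmx_ker row0.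
  move: (row r _) => u uW.
  have uWi i : u 0 0 * W 0 i + u 0 1 * W 1 i = 0.
    have /rowP/(_ i) := uW; rewrite mxE big_ord_recl big_ord1 [X in _ = X -> _]mxE.
    by rewrite (_ : lift ord0 0 = 1) //; apply: val_inj.
  have u1 : u 0 1 = 0.
    by have /eqP := uWi (Ordinal bm); rewrite W0b mulr0 add0r mulf_eq0 (negPf W1b) orbF => /eqP.
  have u0 : u 0 0 = 0.
    have /eqP := uWi (Ordinal am).
    by rewrite u1 mul0r addr0 mulf_eq0 (negPf W0a) orbF => /eqP.
  apply/rowP => r'; rewrite mxE; case: r' => -[|[|//]] r'lt.
    by rewrite -[RHS]u0; congr (u _ _); apply: val_inj.
  by rewrite -[RHS]u1; congr (u _ _); apply: val_inj.
have := Gf _ iota W rankW.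
have -> : (map_mpoly iota f).@[plucker W] = tofrac (schubert_eval a b f).
  apply: (mpoly_rmorphism_ext (phi := meval (plucker W) \o map_mpoly iota)
    (psi := @tofrac D \o schubert_eval a b)) => [c|e] /=.
    by rewrite map_mpolyC mevalC schubert_evalC.
  rewrite map_mpolyX mevalXU schubert_evalX /plucker -/(plucker_pair e).
  by case: (plucker_pair e) => i j; rewrite !mxE /= /schubert_minor rmorphB !rmorphM.
by move/eqP; rewrite tofrac_eq0 => /eqP.
Qed.

End Schubert.

(** * The theorem *)

Lemma subset_of_card (T : finType) (A : {set T}) K : (#|A| <= K <= #|T|)%N ->
  exists2 B : {set T}, A \subset B & #|B| = K.
Proof.
move=> /andP[]; have [n] := ubnP (K - #|A|); elim: n => // n IH in A * => lt le1 le2.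
move: le1; rewrite leq_eqVlt => /predU1P[AK|AK]; first by exists A.
have [x xA] : exists x, x \notin A.
  apply/existsP; apply: contraLR AK => /existsPn allA; rewrite -leqNgt (leq_trans le2) //.
  by rewrite subset_leq_card //; apply/fintype.subsetP => x _; have := allA x; rewrite negbK.
have cA : #|x |: A| = #|A|.+1 by rewrite cardsU1 xA.
have [| |//|B AB BK] := IH (x |: A); rewrite ?cA //; first by move: lt; lia.
by exists B => //; apply: fintype.subset_trans AB; apply: finset.subsetUr.
Qed.

Section SchubertSection.
Variables (F : fieldType) (m : nat).
Local Notation S := {mpoly F[nplucker m]}.
Local Notation V := 'rV[F]_(nplucker m).
Implicit Types (f : S) (i j : 'I_m) (T : {set 'I_(nplucker m)}).

Definition coordinate_vectors (T : {set 'I_(nplucker m)}) : #|T|.-tuple V :=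
  [tuple delta_mx 0 (enum_val s) | s < #|T|].

Definition coordinate_subspace (T : {set 'I_(nplucker m)}) : {vspace V} :=
  <<coordinate_vectors T>>%VS.

Lemma dim_coordinate_subspace T : \dim (coordinate_subspace T) = #|T|.
Proof.
rewrite -[RHS](size_tuple (coordinate_vectors T)).
apply/eqP; rewrite -/(free _); apply/freeP => c c0 s.
have nthE (s' : 'I_#|T|) : (coordinate_vectors T)`_s' = delta_mx 0 (enum_val s').
  by rewrite -tnth_nth tnth_mktuple.
have /rowP/(_ (enum_val s)) := c0; rewrite summxE [X in _ = X -> _]mxE (bigD1 s) //=.
rewrite nthE !mxE !eqxx mulr1 big1 ?addr0 // => s' ss'.
by rewrite nthE !mxE eqxx /= (inj_eq enum_val_inj) eq_sym (negPf ss') mulr0.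
Qed.

Lemma mem_coordinate_subspace (T : {set 'I_(nplucker m)}) e :
  e \in T -> delta_mx 0 e \in coordinate_subspace T.
Proof.
move=> eT; apply: memv_span; apply/tnthP; exists (enum_rank_in eT e).
by rewrite tnth_mktuple enum_rankK_in.
Qed.

Lemma linear_formE f : f \is 1.-homog -> f = \sum_e f@_U_(e) *: 'X_e.
Proof.
move=> /dhomogP f1; apply/mpolyP => x; rewrite raddf_sum /=.
under eq_bigr do rewrite mcoeffZ mcoeffX.
have [/mdeg1P[e0 /eqP ->]|x1] := boolP (mdeg x == 1%N).
  rewrite (bigD1 e0) //= eqxx mulr1 big1 ?addr0 // => e /negPf ee0.
  by have := mcoeffXU F e e0; rewrite mcoeffX => ->; rewrite ee0 mulr0.
rewrite big1 => [|e _].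
  by apply: memN_msupp_eq0; apply: contra x1 => /f1/eqP.
by case: eqP => [ex|_]; rewrite ?mulr0 //; move: x1; rewrite -ex mdeg1.
Qed.

(** Evaluation at coordinate vectors kills the coefficients of [f] inside [T]; the coordinates
    outside [T] vanish on the Schubert variety. *)
Lemma linear_form_schubert_prime i j T f : (i < j)%N -> plucker_below i j \subset T ->
  f \is 1.-homog -> (forall u : V, u \in coordinate_subspace T -> f.@[u 0] = 0) ->
  @schubert_prime F m i j f.
Proof.
move=> ij ijT f1 fU; have fE := linear_formE f1.
have [ip _ _ _] : homogeneous_prime (@schubert_prime F m i j).
  by have [|] := (ProjP (@schubert_prime F m i j)).1; [apply: schubert_prime_Proj; rewrite ij /=|].
rewrite fE; apply: subspace_sum => [|e _ _]; first exact: ideal_subspace.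
have sp := ideal_subspace ip.
have [eT|eT] := boolP (e \in T); last first.
  apply: subspaceZ => //; apply: schubert_evalX0 => //.
  by apply: contra eT => eij; apply: (fintype.subsetP ijT); rewrite inE.
have: (\sum_e' f@_U_(e') *: 'X_e').@[(delta_mx 0 e : V) 0] = 0.
  by rewrite -fE; apply/fU/mem_coordinate_subspace.
rewrite raddf_sum /= (bigD1 e) //=.
rewrite mevalZ mevalXU mxE !eqxx mulr1 big1 ?addr0 => [->|e' /negPf e'e].
  by rewrite scale0r; case: sp.
by rewrite mevalZ mevalXU mxE e'e andbF mulr0.
Qed.

Definition schubert_variety a b := zero_locus (@schubert_prime F m a b).

Lemma schubert_variety_section i j T : (i < j)%N -> plucker_below i j \subset T ->
  schubert_variety i j `<=` linear_section (coordinate_subspace T).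
Proof.
move=> ij ijT p [pP ijp]; split; split=> // f.
  by move=> Gf; apply/ijp/(grassmannian_schubert_prime _ Gf); rewrite ij /=.
by move=> [f1 fU]; apply/ijp/(linear_form_schubert_prime ij ijT f1).
Qed.

(** With truncated subtraction the pair runs through [(0, 1), ..., (0, b), (1, b), (2, b), ...]. *)
Definition schubert_chain b k := schubert_variety (k.+1 - b) (minn k.+1 b).

Lemma schubert_chainP a b d : (a < b < m)%N -> (a + b = d.+1)%N ->
  irreducible_chain (schubert_variety a b) d (schubert_chain b).
Proof.
move=> /andP[ab bm] abd.
have sub a1 b1 a2 b2 : (a1 <= a2)%N -> (b1 <= b2)%N ->
    schubert_variety a1 b1 `<=` schubert_variety a2 b2.
  move=> a12 b12 p [pP sp]; split=> //.
  by apply: subset_trans sp; apply: schubert_prime_sub.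
split=> k kd.
  split; first by apply/zero_locus_irreducible/schubert_prime_Proj; lia.
  by apply: sub; lia.
split; first by apply: sub; lia.
(* Strictness: the coordinate of the larger pair vanishes on the smaller variety but not at the
   generic point of the larger one. *)
have [] : (k.+2 - b < m)%N /\ (minn k.+2 b < m)%N by lia.
set a1 := (k.+2 - b)%N; set b1 := minn k.+2 b => a1m b1m.
have a1b1 : (a1 < b1)%N by rewrite /a1 /b1; lia.
have [|e ee] := @plucker_pair_surj m (Ordinal a1m) (Ordinal b1m); first by [].
have P1 : Proj (@schubert_prime F m a1 b1) by apply: schubert_prime_Proj; rewrite a1b1.
move=> /(_ (@schubert_prime F m a1 b1)) [|_ sp]; first by split.
have := @schubert_evalX_neq0 F m e; rewrite ee; apply; apply: sp.
apply: schubert_evalX0; first by lia.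
by rewrite ee /= /a1 /b1; lia.
Qed.

End SchubertSection.

Lemma chain_bound_C (F : fieldType) (m : nat) (U : {vspace 'rV[F]_(nplucker m)}) l c :
  irreducible_chain (linear_section U) l c ->
  (l <= 2 * (m - 2))%N /\ C m l <= (\dim U)%:R.
Proof.
move=> /section_chain_bound[i [j [ij lij cardU]]]; have jm := ltn_ord j.
split; first by lia.
(* The pair is lowered until its index sum is exactly [l + 1], which only shrinks the set below
   it. *)
pose j' := minn j l.+1; pose i' := (l.+1 - j')%N.
have j'm : (j' < m)%N by rewrite /j'; lia.
have i'm : (i' < m)%N by rewrite /i' /j'; lia.
have i'j' : (i' < j')%N by rewrite /i' /j'; lia.
pose A := plucker_below (Ordinal i'm) (Ordinal j'm).
have AU : (#|A| <= \dim U)%N.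
  rewrite -(leq_pmul2l (ltn0Sn 1)); apply: leq_trans cardU.
  apply: leq_trans (card_schubert_set i j); rewrite leq_pmul2l //.
  by apply/subset_leq_card/plucker_below_sub; rewrite /= /i' /j'; lia.
apply: le_trans (_ : #|A|%:R <= _); last by rewrite ler_nat.
apply: (C_le_below (i := i') (j := j')); first by rewrite i'j'.
  by rewrite /i' /j'; lia.
exact: (@card_plucker_below m (Ordinal i'm) (Ordinal j'm)).
Qed.

Theorem theorem7p2 (F : fieldType) (m K : nat) (hm : (3 <= m)%N)
    (hK : (1 <= K <= 'C(m, 2))%N) :
  exists d : nat,
    is_maximum (fun e => (e <= 2 * (m - 2))%N /\ C m e <= K%:R) d /\
    is_maximum (fun e =>
      exists (U : {vspace 'rV[F]_(nplucker m)})
             (Z : set (set {mpoly F[nplucker m]})),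
        [/\ \dim U = K, component (linear_section U) Z & Krull_dim Z e]) d.
Proof.
have /andP[K1 KC] := hK.
pose P e := (e <= 2 * (m - 2))%N && (C m e <= K%:R).
have P0 : exists e, P e.
  by exists 0%N; rewrite /P /C leq0n add0r /= ler1n.
have Pb e : P e -> (e <= 2 * (m - 2))%N by case/andP.
case: (ex_maxnP P0 Pb) => d /andP[dm dK] dmax; exists d.
have max_d U l c : \dim U = K -> irreducible_chain (@linear_section F m U) l c -> (l <= d)%N.
  by move=> UK /chain_bound_C[lm lK]; apply: dmax; rewrite /P lm -UK.
split; first by split=> // e [em eK]; apply: dmax; rewrite /P em.
split; last first.
  move=> e [U [Z [UK [_ ZU _] [[c [cirr clt]] _]]]]; apply: (max_d U e c) => //.
  by split=> // k /cirr[? cZ]; split=> //; apply: subset_trans ZU.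
have [i [j [ijm ijd HN]]] := C_le_witness hm dm dK.
have /andP[ij jm] := ijm; have im := ltn_trans ij jm.
pose A := plucker_below (Ordinal im) (Ordinal jm).
have AK : (#|A| <= K)%N.
  by apply: HN; apply: (@card_plucker_below m (Ordinal im) (Ordinal jm)).
(* Extra coordinates bring the dimension up to [K]; the section still contains the Schubert
   variety. *)
have [|T AT TK] := @subset_of_card _ A K; first by rewrite AK card_ord npluckerE.
pose U := coordinate_subspace F T; pose Z := @schubert_variety F m i j.
have UK : \dim U = K by rewrite dim_coordinate_subspace.
have ZU : Z `<=` linear_section U.
  exact: (@schubert_variety_section F m (Ordinal im) (Ordinal jm)).
have chainZ := schubert_chainP F ijm ijd.
have subch X Y l c : X `<=` Y -> irreducible_chain X l c ->
    @irreducible_chain F (nplucker m) Y l c.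
  move=> XY [cirr clt]; split=> // k /cirr[? cX]; split=> //; exact: subset_trans XY.
exists U, Z; split=> //; last first.
  split; first by exists (@schubert_chain F m j).
  by move=> l [c cZ]; apply: (max_d U l c) => //; apply: subch ZU cZ.
have Zirr : irreducible_closed Z by apply/zero_locus_irreducible/schubert_prime_Proj.
(* A strictly larger irreducible [Y] in the section could be appended to the chain of [Z], giving
   length [d + 1], against [max_d]. *)
split=> // Y Yirr YU ZY; apply/seteqP; split=> //; apply: contrapT => YZ.
have [cirr clt] := chainZ.
suff : (d.+1 <= d)%N by rewrite ltnn.
apply: (max_d U _ (fun k => if (k <= d)%N then @schubert_chain F m j k else Y)) => //.
split=> k kd.
  case: leqP => kd'; last by split.
  have [ci cZ] := cirr k kd'; split=> //.
  by apply: subset_trans ZU.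
rewrite -ltnS kd /=; move: kd; rewrite ltnS leq_eqVlt => /predU1P[->|kd]; last first.
  by rewrite kd; apply: clt.
rewrite ltnn; split.
  by apply: subset_trans ZY; case: (cirr d (leqnn d)).
move=> Yd; apply: YZ; apply: subset_trans Yd _.
by case: (cirr d (leqnn d)).
Qed.
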